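(* Let $\phi : (M^2,g) \to (N,h)$ be a biharmonic map defined on a surface $M^2$. Then the rough Laplacian of its biharmonic stress-energy tensor $S_2$ is $$\Delta^{R}S_2= - 2 K^{M}S_2 + \nabla d (|\tau(\phi)|^2) +\Big\{K^{M}|\tau(\phi)|^2 + \Delta|\tau(\phi)|^2\Big\}g ,$$ where $K^M$ is the Gaussian curvature of $(M^2,g)$.
   Context: All objects are smooth; $(M^2,g)$ is a two-dimensional Riemannian manifold and $(N,h)$ a Riemannian manifold. The curvature convention is $R(X,Y)=[\nabla_X,\nabla_Y]-\nabla_{[X,Y]}$. For a smooth map $\phi$, $\nabla$ also denotes the pull-back connection $\nabla^\phi$ on $\phi^{-1}TN$, and $\tau(\phi)=\mathrm{trace}\,\nabla d\phi$ is the tension field. The map $\phi$ is biharmonic if $\tau_2(\phi)=\mathrm{trace}(\nabla^\phi)^2\tau(\phi)-\mathrm{trace}\,R^N(d\phi(\cdot),\tau(\phi))d\phi(\cdot)=0$. The biharmonic stress-energy tensor is the symmetric $(0,2)$-tensor $$S_2(X,Y)=\Big\{\tfrac{|\tau(\phi)|^2}{2}+\langle d\phi,\nabla\tau(\phi)\rangle\Big\}g(X,Y)-\langle d\phi(X),\nabla_Y\tau(\phi)\rangle-\langle d\phi(Y),\nabla_X\tau(\phi)\rangle ,$$ with $\langle d\phi,\nabla\tau(\phi)\rangle=\sum_i\langle d\phi(X_i),\nabla_{X_i}\tau(\phi)\rangle$ for an orthonormal frame $\{X_i\}$. Sign conventions: $\Delta^R S=-\mathrm{trace}\,\nabla^2S$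 on tensors and $\Delta f=-\mathrm{div}\,\mathrm{grad} f$ on functions (so $\Delta f=-f''$ on the real line). $\nabla df$ is the Hessian of $f$. *)

(* Defs.v *)
From HB Require Import structures.
From mathcomp Require Import all_boot all_order all_algebra.
From mathcomp Require Import all_classical all_reals.
From mathcomp Require Import topology normedtype derive.

Set Implicit Arguments.
Unset Strict Implicit.
Unset Printing Implicit Defensive.
Import Order.TTheory GRing.Theory Num.Theory.
Import numFieldNormedType.Exports.
Local Open Scope classical_set_scope.
Local Open Scope ring_scope.

(* Manifolds are given by smooth atlases and tensor fields by their components
   in charts.  The points of R^m are row vectors, so a linear map acts by right
   multiplication and the matrix of a bilinear form B in the coordinate frame
   (d_1, .., d_m) is (B(d_i, d_j))_(i, j).

   The operations of the sections below are local: they act on functions that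
   are defined on all of R^m but are meaningful only on an open set (the image
   of a chart), and their value at a point depends only on the germs of their
   arguments there. *)

Section Calculus.
Context {R : realType}.

Definition partial m (V : normedModType R) (k : 'I_m) (f : 'rV[R]_m -> V)
  : 'rV[R]_m -> V := fun x => 'D_(delta_mx 0 k) f x.

(* C^infinity on an open set U: all the iterated partial derivatives exist and
   are Frechet differentiable (hence continuous) at every point of U. *)
Definition smooth_on m (V : normedModType R) (U : set 'rV[R]_m)
  (f : 'rV[R]_m -> V) : Prop :=
  forall (s : seq 'I_m) (x : 'rV[R]_m), U x ->
    differentiable (foldr (@partial m V) f s) x.

Definition bilin m (B : 'M[R]_m) (u v : 'rV[R]_m) : R := (u *m B *m v^T) 0 0.

End Calculus.

Section Manifolds.
Context {R : realType}.

Record chart (n : nat) (T : topologicalType) := Chart {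
  chart_dom : set T;
  chart_img : set 'rV[R]_n;
  chart_map :> T -> 'rV[R]_n;
  chart_inv : 'rV[R]_n -> T;
  chart_dom_open : open chart_dom;
  chart_img_open : open chart_img;
  chart_mapP : forall p, chart_dom p -> chart_img (chart_map p);
  chart_invP : forall x, chart_img x -> chart_dom (chart_inv x);
  chart_mapK : forall p, chart_dom p -> chart_inv (chart_map p) = p;
  chart_invK : forall x, chart_img x -> chart_map (chart_inv x) = x;
  chart_map_continuous : {within chart_dom, continuous chart_map};
  chart_inv_continuous : {within chart_img, continuous chart_inv} }.

(* The expression of phi in the charts c and d, and the open set of R^m on
   which it is meaningful. *)
Definition local_rep m n (S T : topologicalType) (phi : S -> T)
  (c : chart m S) (d : chart n T) : 'rV[R]_m -> 'rV[R]_n :=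
  fun x => d (phi (chart_inv c x)).

Definition local_rep_dom m n (S T : topologicalType) (phi : S -> T)
  (c : chart m S) (d : chart n T) : set 'rV[R]_m :=
  [set x | chart_img c x /\ chart_dom d (phi (chart_inv c x))].

Record manifold (n : nat) := Manifold {
  manifold_carrier :> topologicalType;
  atlas : set (chart n manifold_carrier);
  manifold_hausdorff : hausdorff_space manifold_carrier;
  manifold_second_countable : @second_countable manifold_carrier;
  atlas_cover : forall p : manifold_carrier,
    exists2 c, atlas c & chart_dom c p;
  atlas_smooth : forall c c', atlas c -> atlas c' ->
    smooth_on (local_rep_dom id c c') (local_rep id c c') }.
Arguments atlas {n} m : rename.

Definition smooth_map m n (M : manifold m) (N : manifold n) (phi : M -> N) :=
  continuous phi /\
  forall c d, atlas M c -> atlas N d ->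
    smooth_on (local_rep_dom phi c d) (local_rep phi c d).

(* [gram c x] is the Gram matrix of the coordinate frame of the chart c at the
   point of coordinates x; the values of gram outside of the atlas, or outside
   of the image of c, are irrelevant. *)
Record riemannian_metric n (M : manifold n) := RiemannianMetric {
  gram :> chart n M -> 'rV[R]_n -> 'M[R]_n;
  gram_smooth : forall c, atlas M c -> smooth_on (chart_img c) (gram c);
  gram_sym : forall c x, atlas M c -> chart_img c x ->
    (gram c x)^T = gram c x;
  gram_pos : forall c x v, atlas M c -> chart_img c x -> v != 0 ->
    0 < bilin (gram c x) v v;
  gram_change : forall c c' x, atlas M c -> atlas M c' ->
    local_rep_dom id c c' x ->
    gram c x = 'J (local_rep id c c') x *m gram c' (local_rep id c c' x)
               *m ('J (local_rep id c c') x)^T }.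

End Manifolds.
Arguments chart R n T : clear implicits.
Arguments manifold R n : clear implicits.
Arguments atlas {R n} m : rename.

Section RiemannianGeometry.
Context {R : realType} {m : nat}.
Local Notation E := 'rV[R]_m.
Variable G : E -> 'M[R]_m.
Implicit Types (x u v w : E) (i j k l p : 'I_m) (f : E -> R).

(* The trace of a bilinear form with values in V and components B i j. *)
Definition gtrace (V : lmodType R) x (B : 'I_m -> 'I_m -> V) : V :=
  \sum_i \sum_j invmx (G x) i j *: B i j.

Lemma gtrace_orthonormal (V : lmodType R) x (B : 'I_m -> 'I_m -> V)
    (X : 'I_m -> E) :
  (forall i j, bilin (G x) (X i) (X j) = (i == j)%:R) ->
  gtrace x B = \sum_i \sum_k \sum_l (X i 0 k * X i 0 l) *: B k l.
Proof.
move=> orthoX; pose F : 'M[R]_m := \matrix_i X i.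
have FGF : F *m (G x *m F^T) = 1%:M.
  apply/matrixP => i j; rewrite mulmxA.
  have -> : (F *m G x *m F^T) i j = bilin (G x) (X i) (X j).
    have -> : F *m G x *m F^T = \matrix_(a, b) bilin (G x) (X a) (X b).
      apply/matrixP => a b; rewrite /bilin !mxE; apply: eq_bigr => k _.
      by rewrite !mxE; congr (_ * _); apply: eq_bigr => l _; rewrite !mxE.
    by rewrite mxE.
  by rewrite orthoX mxE.
have invG : invmx (G x) = F^T *m F.
  have := mulmx1C FGF; rewrite -mulmxA => GFF.
  by have [uG _] := mulmx1_unit GFF; rewrite -[RHS]mul1mx -(mulVmx uG) -mulmxA
    GFF mulmx1.
rewrite /gtrace invG.
under eq_bigr => k _ do under eq_bigr => l _ do rewrite mxE scaler_suml.
under eq_bigr => k _ do rewrite exchange_big /=.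
rewrite exchange_big /=; apply: eq_bigr => i _; apply: eq_bigr => k _.
by apply: eq_bigr => l _; rewrite !mxE.
Qed.

(* Levi-Civita connection: nabla_(d_i) d_j = sum_k christoffel k i j d_k. *)
Definition christoffel k i j x : R :=
  2^-1 * \sum_l invmx (G x) k l *
    (partial i (fun y => G y j l) x + partial j (fun y => G y i l) x
     - partial l (fun y => G y i j) x).

(* R(d_i, d_j) d_k = sum_l (riemann l k i j) d_l,
   where R(X, Y) = [nabla_X, nabla_Y] - nabla_[X, Y]. *)
Definition riemann l k i j x : R :=
  partial i (christoffel l j k) x - partial j (christoffel l i k) x
  + \sum_p (christoffel l i p x * christoffel p j k x
            - christoffel l j p x * christoffel p i k x).

(* R(u, v) w *)
Definition curvature x u v w : E :=
  \row_l \sum_i \sum_j \sum_k u 0 i * v 0 j * w 0 k * riemann l k i j x.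

Definition sectional_curvature x u v : R :=
  bilin (G x) (curvature x u v v) u /
  (bilin (G x) u u * bilin (G x) v v - bilin (G x) u v ^+ 2).

Definition gradient f x : E :=
  \row_k \sum_l invmx (G x) k l * partial l f x.

Definition divergence (X : E -> E) x : R :=
  \sum_k (partial k (fun y => X y 0 k) x
          + \sum_p christoffel k k p x * X x 0 p).

Definition laplacian f x : R := - divergence (gradient f) x.

Definition hessian f x : 'M[R]_m :=
  \matrix_(i, j) (partial i (partial j f) x
                  - \sum_k christoffel k i j x * partial k f x).

(* (nabla_(d_k) S)(d_i, d_j) *)
Definition nabla2 (S : E -> 'M[R]_m) k i j x : R :=
  partial k (fun y => S y i j) x
  - \sum_p (christoffel p k i x * S x p j + christoffel p k j x * S x i p).

(* (nabla^2 S)(d_l, d_k; d_i, d_j) = (nabla_(d_l) (nabla S))(d_k; d_i, d_j) *)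
Definition nabla_nabla2 (S : E -> 'M[R]_m) l k i j x : R :=
  partial l (nabla2 S k i j) x
  - \sum_p (christoffel p l k x * nabla2 S p i j x
            + christoffel p l i x * nabla2 S k p j x
            + christoffel p l j x * nabla2 S k i p x).

Definition rough_laplacian (S : E -> 'M[R]_m) x : 'M[R]_m :=
  \matrix_(i, j) - gtrace x (fun l k => nabla_nabla2 S l k i j x).

End RiemannianGeometry.

Definition gauss_curvature {R : realType} (G : 'rV[R]_2 -> 'M[R]_2)
  (x : 'rV[R]_2) : R :=
  sectional_curvature G x (delta_mx 0 0) (delta_mx 0 1).

Section Maps.
Context {R : realType} {m n : nat}.
Variables (G : 'rV[R]_m -> 'M[R]_m) (H : 'rV[R]_n -> 'M[R]_n).
(* phi is the expression of a map in charts; sections of phi^-1 TN are given by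
   their components in the coordinate frame of the target chart. *)
Variable phi : 'rV[R]_m -> 'rV[R]_n.
Implicit Types (x : 'rV[R]_m) (i j k : 'I_m) (s t : 'rV[R]_m -> 'rV[R]_n).

(* Pull-back connection: nabla^phi_(d_k) s. *)
Definition nabla_pb k s x : 'rV[R]_n :=
  partial k s x
  + \row_a \sum_b \sum_c
      christoffel H a b c (phi x) * partial k phi x 0 b * s x 0 c.

Definition inner_pb s t x : R := bilin (H (phi x)) (s x) (t x).

(* (nabla d phi)(d_i, d_j); here [partial j phi] is d phi (d_j). *)
Definition second_fundamental_form i j x : 'rV[R]_n :=
  nabla_pb i (partial j phi) x
  - \sum_k christoffel G k i j x *: partial k phi x.

Definition tension x : 'rV[R]_n :=
  gtrace G x (fun i j => second_fundamental_form i j x).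

Definition trace_nabla_pb2 s x : 'rV[R]_n :=
  gtrace G x (fun i j => nabla_pb i (nabla_pb j s) x
                         - \sum_k christoffel G k i j x *: nabla_pb k s x).

Definition bitension x : 'rV[R]_n :=
  trace_nabla_pb2 tension x
  - gtrace G x (fun i j => curvature H (phi x)
      (partial i phi x) (tension x) (partial j phi x)).

Definition tension_sqnorm x : R := inner_pb tension tension x.

(* < d phi, nabla tau(phi) > *)
Definition inner_dphi_nabla_tension x : R :=
  gtrace G x (fun i j =>
    inner_pb (partial i phi) (nabla_pb j tension) x).

Definition stress_bienergy x : 'M[R]_m :=
  \matrix_(i, j)
    ((tension_sqnorm x / 2 + inner_dphi_nabla_tension x) * G x i j
     - inner_pb (partial i phi) (nabla_pb j tension) x
     - inner_pb (partial j phi) (nabla_pb i tension) x).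

End Maps.

(* The bitension field vanishes at every point p, in all charts of the atlases
   around p and phi p. *)
Definition biharmonic {R : realType} m n (M : manifold R m) (N : manifold R n)
  (g : riemannian_metric M) (h : riemannian_metric N) (phi : M -> N) : Prop :=
  forall (p : M) (c : chart R m M) (d : chart R n N),
    atlas M c -> chart_dom c p ->
    atlas N d -> chart_dom d (phi p) ->
    bitension (g c) (h d) (local_rep phi c d) (c p) = 0.

(* Main.v *)
Require Import Defs.
From HB Require Import structures.
From mathcomp Require Import all_boot all_order all_algebra ring lra.
From mathcomp Require Import all_classical all_reals.
From mathcomp Require Import topology normedtype landau derive.
Import numFieldNormedType.Exports.
Set Implicit Arguments.
Unset Strict Implicit.
Unset Printing Implicit Defensive.
Import Order.TTheory GRing.Theory Num.Theory.
Local Open Scope classical_set_scope.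
Local Open Scope ring_scope.

(** The conclusion is a statement about symmetric tensors on a surface: if S
    is symmetric and divergence free, with trace t, then its rough Laplacian is
    - 2 K S + nabla d t + (K t + Delta t) g.  The tensor S2 is such an S, with
    t = |tau|^2.

    In any dimension m one has div S2 = - < d phi, tau_2(phi) >
    ([astress_divergence_bitension]), so biharmonicity makes S2 divergence free:
    expanding the covariant derivative of S2, the terms that involve the second
    fundamental form cancel by symmetry, the two second covariant derivatives of
    tau that differ in the order of differentiation leave a curvature term of
    the pull-back connection, and the pair symmetry of the curvature of N turns
    it into the curvature term of tau_2.  The trace of S2 is
    (m / 2) |tau|^2 + (m - 2) < d phi, nabla tau >, that is |tau|^2 if m = 2
    ([astress_trace]).

    On a surface, nabla_k S_ij - nabla_i S_kj is alternating in k and i, hence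
    determined by its contraction, which is d t because div S = 0.  This gives
    the Codazzi equation
    nabla_k S_ij = nabla_i S_kj + g_ij t_k - g_kj t_i ([codazzi]).
    Differentiating and tracing it expresses the rough Laplacian by the
    derivatives of t and by the trace of nabla_l nabla_i S_kj over l and k; the
    latter is a derivative of div S up to the curvature terms of the Ricci
    identity, which in dimension two are multiples of K
    ([arough_laplacian_surface]).

    None of this uses more analysis than the product rule, the chain rule and
    the symmetry of second derivatives.  All the tensor calculus is therefore
    done over an abstract commutative ring with commuting derivations, where
    no differentiability has to be checked.  The smooth functions on an open
    set of R^m form such a ring ([smooth_fun], [smooth_der]), composition with a
    smooth map is a morphism between two of them ([pullback]), and the predicates
    [represents] and [represents_mx] relate functions to elements of the ring.
    The ring and the analysis meet in
    [local_rough_laplacian_stress_bienergy]. *)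

(** * Connections over a ring with commuting derivations *)

Record derivations m (A : comPzRingType) := Derivations {
  der :> 'I_m -> {additive A -> A};
  derM : forall k a b, der k (a * b) = der k a * b + a * der k b;
  derC : forall i j a, der i (der j a) = der j (der i a) }.

Section MatrixCalculus.
Variables (m : nat) (A : comPzRingType) (D : derivations m A).
Implicit Types (i j k l : 'I_m).

Lemma der1 k : D k 1 = 0.
Proof.
have := derM D k 1 1; rewrite !mul1r mulr1 => /eqP.
by rewrite -subr_eq0 opprD addNKr oppr_eq0 => /eqP.
Qed.

Lemma der_half (half : A) k : half + half = 1 -> D k half = 0.
Proof.
move=> h; have : D k half + D k half = 0 by rewrite -raddfD h der1.
move=> e; have := congr1 ( *%R half) e.
by rewrite mulr0 mulrDr -mulrDl h mul1r.
Qed.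

Local Notation d k := (map_mx (D k)).

Lemma trmxD p q (M N : 'M[A]_(p, q)) : (M + N)^T = M^T + N^T.
Proof. exact: linearD. Qed.

Lemma trmxN p q (M : 'M[A]_(p, q)) : (- M)^T = - M^T.
Proof. exact: linearN. Qed.

Lemma der_mulmx k p q r (M : 'M[A]_(p, q)) (N : 'M[A]_(q, r)) :
  d k (M *m N) = d k M *m N + M *m d k N.
Proof.
apply/matrixP => i j; rewrite !mxE raddf_sum -big_split.
by apply: eq_bigr => l _; rewrite derM !mxE.
Qed.

Lemma der_trmx k p q (M : 'M[A]_(p, q)) : d k M^T = (d k M)^T.
Proof. by rewrite map_trmx. Qed.

Lemma der_mxC i j p q (M : 'M[A]_(p, q)) : d i (d j M) = d j (d i M).
Proof. by apply/matrixP => a b; rewrite !mxE derC. Qed.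

Lemma der_mx1 k p : d k (1%:M : 'M[A]_p) = 0.
Proof.
apply/matrixP => i j; rewrite !mxE.
by case: (i == j); rewrite ?der1 ?raddf0.
Qed.

(** A family w of matrices is a connection on the free module of rank n: row a
    of [w k] holds the coordinates of the derivative of the a-th frame vector in
    direction k.  Sections are row vectors. *)
Definition cov n (w : 'I_m -> 'M[A]_n) k p (s : 'M[A]_(p, n)) := d k s + s *m w k.

(** With row vectors, the curvature operator acts by right multiplication; this
    accounts for the order of the factors in the commutator. *)
Definition curv_form n (w : 'I_m -> 'M[A]_n) i j : 'M[A]_n :=
  d i (w j) - d j (w i) + w j *m w i - w i *m w j.

Definition metric_connection n (w : 'I_m -> 'M[A]_n) (h : 'M[A]_n) :=
  forall k, d k h = w k *m h + h *m (w k)^T.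

Lemma cov_commutator n (w : 'I_m -> 'M[A]_n) i j p (s : 'M[A]_(p, n)) :
  cov w i (cov w j s) - cov w j (cov w i s) = s *m curv_form w i j.
Proof.
rewrite /cov /curv_form !map_mxD !der_mulmx (der_mxC i j).
rewrite !mulmxDl !mulmxDr !mulmxN !mulmxA.
apply/matrixP => x y; rewrite !mxE; ring.
Qed.

Lemma curv_formC n (w : 'I_m -> 'M[A]_n) i j : curv_form w j i = - curv_form w i j.
Proof. by apply/matrixP => x y; rewrite !mxE; ring. Qed.

Definition inner n (h : 'M[A]_n) (s t : 'rV[A]_n) : A := (s *m h *m t^T) 0 0.

Lemma innerDl n (h : 'M[A]_n) s s' t : inner h (s + s') t = inner h s t + inner h s' t.
Proof. by rewrite /inner !mulmxDl mxE. Qed.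
Lemma innerDr n (h : 'M[A]_n) s t t' : inner h s (t + t') = inner h s t + inner h s t'.
Proof. by rewrite /inner linearD mulmxDr mxE. Qed.
Lemma innerZl n (h : 'M[A]_n) a s t : inner h (a *: s) t = a * inner h s t.
Proof. by rewrite /inner -!scalemxAl mxE. Qed.
Lemma innerZr n (h : 'M[A]_n) a s t : inner h s (a *: t) = a * inner h s t.
Proof. by rewrite /inner linearZ -scalemxAr mxE. Qed.
Lemma innerNl n (h : 'M[A]_n) s t : inner h (- s) t = - inner h s t.
Proof. by rewrite -scaleN1r innerZl mulN1r. Qed.
Lemma innerNr n (h : 'M[A]_n) s t : inner h s (- t) = - inner h s t.
Proof. by rewrite -scaleN1r innerZr mulN1r. Qed.
Lemma inner0l n (h : 'M[A]_n) t : inner h 0 t = 0.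
Proof. by rewrite -(scale0r 0) innerZl mul0r. Qed.
Lemma inner0r n (h : 'M[A]_n) t : inner h t 0 = 0.
Proof. by rewrite -(scale0r 0) innerZr mul0r. Qed.
Lemma inner_suml n (h : 'M[A]_n) I (r : seq I) (P : pred I) (F : I -> 'rV[A]_n) t :
  inner h (\sum_(i <- r | P i) F i) t = \sum_(i <- r | P i) inner h (F i) t.
Proof.
by apply: (big_morph (fun s => inner h s t)) => [a b|]; rewrite ?innerDl ?inner0l.
Qed.
Lemma inner_sumr n (h : 'M[A]_n) I (r : seq I) (P : pred I) (F : I -> 'rV[A]_n) s :
  inner h s (\sum_(i <- r | P i) F i) = \sum_(i <- r | P i) inner h s (F i).
Proof.
by apply: (big_morph (fun t => inner h s t)) => [a b|]; rewrite ?innerDr ?inner0r.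
Qed.
Lemma innerC n (h : 'M[A]_n) s t : h^T = h -> inner h s t = inner h t s.
Proof.
move=> hT; rewrite /inner.
have -> : s *m h *m t^T = (t *m h *m s^T)^T by rewrite !trmx_mul hT trmxK mulmxA.
by rewrite mxE.
Qed.

Lemma der_inner n (w : 'I_m -> 'M[A]_n) (h : 'M[A]_n) k s t :
  metric_connection w h ->
  D k (inner h s t) = inner h (cov w k s) t + inner h s (cov w k t).
Proof.
move=> wh.
have -> : D k (inner h s t) = (d k (s *m h *m t^T)) 0 0 by rewrite mxE.
rewrite !der_mulmx der_trmx wh /inner /cov trmxD trmx_mul.
rewrite !(mulmxDl, mulmxDr) !mulmxA.
have addE (X Y : 'M[A]_1) : (X + Y) 0 0 = X 0 0 + Y 0 0 by rewrite mxE.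
rewrite !addE; ring.
Qed.

(** The second derivatives of h commute; when they are written with the
    connection, everything cancels but the curvature. *)
Lemma curv_form_skew n (w : 'I_m -> 'M[A]_n) (h : 'M[A]_n) i j :
  metric_connection w h -> curv_form w i j *m h + h *m (curv_form w i j)^T = 0.
Proof.
move=> wh; have := der_mxC i j h.
rewrite !wh !map_mxD !der_mulmx !der_trmx !wh /curv_form !(trmxD, trmxN, trmx_mul).
rewrite !(mulmxDl, mulmxDr, mulmxN, mulNmx) !mulmxA => /matrixP e.
apply/matrixP => a b; have := e a b; rewrite !mxE.
by move=> /eqP; rewrite -subr_eq0 => /eqP e0; rewrite -[RHS]e0; ring.
Qed.
End MatrixCalculus.

(** * The Levi-Civita connection of a metric matrix *)

Section LeviCivita.
Variables (m : nat) (A : comPzRingType) (D : derivations m A).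
Implicit Types (i j k l p : 'I_m).
Variables (half : A) (g q : 'M[A]_m).
Local Notation d k := (map_mx (D k)).

(** [Gamma] and the operators with prefix a are the operators on tensor fields
    in a chart, written in the ring; g is the metric, q its inverse and half the
    inverse of 2. *)
Definition Gamma k i j : A :=
  half * \sum_l q k l * (D i (g j l) + D j (g i l) - D l (g i j)).

Definition conn_form k : 'M[A]_m := \matrix_(i, p) Gamma p k i.

Definition ariemann l k i j : A :=
  D i (Gamma l j k) - D j (Gamma l i k)
  + \sum_p (Gamma l i p * Gamma p j k - Gamma l j p * Gamma p i k).

Definition ahessian (f : A) i j : A := D i (D j f) - \sum_k Gamma k i j * D k f.

Definition alaplacian (f : A) : A :=
  - \sum_k (D k (\sum_l q k l * D l f)
            + \sum_p Gamma k k p * \sum_l q p l * D l f).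

Definition anabla2 (S : 'M[A]_m) k i j : A :=
  D k (S i j) - \sum_p (Gamma p k i * S p j + Gamma p k j * S i p).

Definition anabla_nabla2 (S : 'M[A]_m) l k i j : A :=
  D l (anabla2 S k i j)
  - \sum_p (Gamma p l k * anabla2 S p i j + Gamma p l i * anabla2 S k p j
            + Gamma p l j * anabla2 S k i p).

Definition agtrace (V : lmodType A) (B : 'I_m -> 'I_m -> V) : V :=
  \sum_i \sum_j q i j *: B i j.

Hypothesis (halfE : half + half = 1) (gT : g^T = g) (gq : g *m q = 1%:M).

Let gC i j : g i j = g j i. Proof. by rewrite -[in LHS]gT mxE. Qed.
Lemma metric_qg : q *m g = 1%:M. Proof. exact: mulmx1C. Qed.
Lemma metric_qT : q^T = q.
Proof.
rewrite -[LHS]mulmx1 -gq mulmxA -[in LHS]gT -trmx_mul gq.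
by rewrite trmx1 mul1mx.
Qed.
Let qC i j : q i j = q j i. Proof. by rewrite -[in LHS]metric_qT mxE. Qed.

Lemma ariemannE l k i j : ariemann l k i j = curv_form D conn_form i j k l.
Proof.
rewrite /ariemann /curv_form !mxE -addrA; congr (_ + _).
rewrite -sumrB; apply: eq_bigr => p _.
by rewrite !mxE mulrC (mulrC (Gamma p i k)).
Qed.

Lemma GammaC k i j : Gamma k i j = Gamma k j i.
Proof.
by rewrite /Gamma; congr (_ * _); apply: eq_bigr => l _; rewrite (gC i j) (addrC (D i _)).
Qed.

(** Koszul's formula: contracting the Christoffel symbols with g leaves the sum
    of three derivatives of g, and symmetrizing it leaves one. *)
Lemma conn_form_metric : metric_connection D conn_form g.
Proof.
move=> k.
pose Y : 'M[A]_m := \matrix_(i, l) (D k (g i l) + D i (g k l) - D l (g k i)).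
have lcE : conn_form k = half *: (Y *m q).
  apply/matrixP => i p; rewrite !mxE /Gamma; congr (_ * _).
  by apply: eq_bigr => l _; rewrite !mxE mulrC (qC l).
have lcg : conn_form k *m g = half *: Y.
  by rewrite lcE -scalemxAl -mulmxA metric_qg mulmx1.
have -> : g *m (conn_form k)^T = (conn_form k *m g)^T by rewrite trmx_mul gT.
rewrite lcg; apply/matrixP => i j; rewrite !mxE (gC j i) (gC k j) (gC k i).
by rewrite -mulrDr -[LHS]mul1r -halfE; ring.
Qed.

Lemma der_metric k i j :
  D k (g i j) = \sum_p (Gamma p k i * g p j + Gamma p k j * g i p).
Proof.
have /matrixP/(_ i j) := conn_form_metric k; rewrite !mxE => ->; rewrite -big_split.
by apply: eq_bigr => p _; rewrite !mxE (mulrC (g i p)).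
Qed.

Lemma der_inverse_metric k :
  d k q = - ((conn_form k)^T *m q + q *m conn_form k).
Proof.
have e : d k g *m q + g *m d k q = 0 by rewrite -der_mulmx gq der_mx1.
have -> : d k q = - (q *m (d k g *m q)).
  move/eqP: e; rewrite addr_eq0 => /eqP ->.
  by rewrite mulmxN opprK mulmxA metric_qg mul1mx.
rewrite conn_form_metric; congr (- _).
rewrite mulmxDl mulmxDr -!mulmxA gq mulmx1 addrC; congr (_ + _).
by rewrite !mulmxA metric_qg mul1mx.
Qed.

Lemma der_inverse_metricE k i j :
  D k (q i j) = - \sum_p (Gamma i k p * q p j + Gamma j k p * q i p).
Proof.
have /matrixP/(_ i j) := der_inverse_metric k; rewrite !mxE => ->.
rewrite -big_split; congr (- _).
by apply: eq_bigr => p _; rewrite !mxE (mulrC (q i p)).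
Qed.

Lemma anabla2_mx (S : 'M[A]_m) k i j :
  anabla2 S k i j = (d k S - conn_form k *m S - S *m (conn_form k)^T) i j.
Proof.
rewrite !mxE /anabla2 -addrA -opprD -big_split /=; congr (_ - _).
by apply: eq_bigr => p _; rewrite !mxE (mulrC (S i p)).
Qed.

Lemma ahessianC f i j : ahessian f i j = ahessian f j i.
Proof.
by rewrite /ahessian derC; congr (_ - _); apply: eq_bigr => k _; rewrite GammaC.
Qed.

(** Contraction commutes with covariant differentiation, because the metric is
    parallel. *)
Lemma der_contract k (T : 'I_m -> 'I_m -> A) :
  D k (\sum_a \sum_b q a b * T a b) =
  \sum_a \sum_b q a b * (D k (T a b)
     - \sum_p (Gamma p k a * T p b + Gamma p k b * T a p)).
Proof.
have E1 : \sum_a \sum_b (\sum_p (Gamma a k p * q p b)) * T a b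
        = \sum_a \sum_b q a b * \sum_p (Gamma p k a * T p b).
  under eq_bigr => a _ do under eq_bigr => b _ do rewrite mulr_suml.
  under [RHS]eq_bigr => a _ do under eq_bigr => b _ do rewrite mulr_sumr.
  rewrite exchange_big [RHS]exchange_big /=; apply: eq_bigr => b _.
  rewrite exchange_big /=; apply: eq_bigr => a _; apply: eq_bigr => p _; ring.
have E2 : \sum_a \sum_b (\sum_p (Gamma b k p * q a p)) * T a b
        = \sum_a \sum_b q a b * \sum_p (Gamma p k b * T a p).
  apply: eq_bigr => a _.
  under eq_bigr => b _ do rewrite mulr_suml.
  under [RHS]eq_bigr => b _ do rewrite mulr_sumr.
  rewrite exchange_big /=; apply: eq_bigr => b _; apply: eq_bigr => p _; ring.
rewrite raddf_sum.
under eq_bigr => a _ do rewrite raddf_sum.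
under eq_bigr => a _ do under eq_bigr => b _ do
  rewrite derM der_inverse_metricE big_split opprD mulrDl !mulNr.
under [RHS]eq_bigr => a _ do under eq_bigr => b _ do
  rewrite big_split mulrBr mulrDr opprD.
under eq_bigr => a _ do rewrite !big_split !sumrN.
rewrite !big_split !sumrN E1 E2 /=.
under [RHS]eq_bigr => a _ do rewrite !big_split !sumrN.
rewrite !big_split !sumrN /=; ring.
Qed.

Lemma alaplacianE f : alaplacian f = - \sum_k \sum_l q k l * ahessian f k l.
Proof.
rewrite /alaplacian /ahessian; congr (- _).
have E1 : \sum_k \sum_l (\sum_p (Gamma k k p * q p l)) * D l f
        = \sum_k \sum_p Gamma k k p * \sum_l q p l * D l f.
  apply: eq_bigr => k _.
  under eq_bigr => b _ do rewrite mulr_suml.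
  rewrite exchange_big /=; apply: eq_bigr => p _; rewrite mulr_sumr.
  by apply: eq_bigr => l _; rewrite mulrA.
have E2 : \sum_k \sum_l (\sum_p (Gamma l k p * q k p)) * D l f
        = \sum_k \sum_l q k l * \sum_p (Gamma p k l * D p f).
  apply: eq_bigr => a _.
  under eq_bigr => b _ do rewrite mulr_suml.
  under [RHS]eq_bigr => b _ do rewrite mulr_sumr.
  rewrite exchange_big /=; apply: eq_bigr => b _; apply: eq_bigr => p _; ring.
under eq_bigr => a _ do rewrite raddf_sum.
under eq_bigr => a _ do under eq_bigr => b _ do
  rewrite derM der_inverse_metricE big_split opprD mulrDl !mulNr.
under [RHS]eq_bigr => a _ do under eq_bigr => b _ do rewrite mulrBr.
under eq_bigr => a _ do rewrite !big_split !sumrN.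
rewrite !big_split !sumrN E1 E2 /=.
under [RHS]eq_bigr => a _ do rewrite !big_split !sumrN.
rewrite !big_split !sumrN /=; ring.
Qed.

(** Seen as operators L_k on matrices, the covariant derivatives in the
    directions k commute up to the curvature acting on both indices; the
    remaining Christoffel terms are symmetric and cancel. *)
Lemma ricci_identity (S : 'M[A]_m) i j a b :
  anabla_nabla2 S i j a b - anabla_nabla2 S j i a b =
  - (curv_form D conn_form i j *m S + S *m (curv_form D conn_form i j)^T) a b.
Proof.
pose L k (X : 'M[A]_m) := d k X - conn_form k *m X - X *m (conn_form k)^T.
have LE k X x y : anabla2 X k x y = L k X x y by exact: anabla2_mx.
have ddE k l : anabla_nabla2 S k l a b =
    L k (L l S) a b - \sum_p Gamma p k l * L p S a b.
  rewrite /anabla_nabla2; under eq_bigr => p _ do rewrite !LE -addrA.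
  rewrite big_split /= LE -[L k _ a b]LE /anabla2; ring.
rewrite !ddE opprD opprK addrACA [X in _ + X](_ : _ = 0); last first.
  under eq_bigr => p _ do rewrite GammaC.
  by rewrite addNr.
rewrite addr0 /L /curv_form !map_mxD !(trmxD, trmxN) !map_mxN.
rewrite !der_mulmx !der_trmx (der_mxC D j i).
rewrite !trmx_mul !(mulmxDl, mulmxDr, mulmxN, mulNmx) !mulmxA.
rewrite !mxE; ring.
Qed.
End LeviCivita.

(** * Symmetric divergence-free tensors on a surface *)

Lemma sum_ord2 (V : nmodType) (F : 'I_2 -> V) : \sum_i F i = F 0 + F 1.
Proof.
by rewrite !big_ord_recl big_ord0 addr0; congr (_ + F _); apply: val_inj.
Qed.

Lemma ord2P (i : 'I_2) : i = 0 \/ i = 1.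
Proof. by case: i => [[|[|//]] ?]; [left|right]; apply: val_inj. Qed.

Section Surface.
Variables (A : comPzRingType) (D : derivations 2 A).
Variables (half : A) (g q : 'M[A]_2).
Implicit Types i j k l : 'I_2.
Local Notation Om := (curv_form D (conn_form D half g q)).
Hypothesis (halfE : half + half = 1) (gT : g^T = g) (gq : g *m q = 1%:M).
Let gC i j : g i j = g j i. Proof. by rewrite -[in LHS]gT mxE. Qed.
Let qC i j : q i j = q j i.
Proof. by rewrite -[in LHS](metric_qT gT gq) mxE. Qed.

Let qgE i j : q i 0 * g 0 j + q i 1 * g 1 j = (i == j)%:R.
Proof. by have /matrixP/(_ i j) := metric_qg gq; rewrite !mxE sum_ord2. Qed.

(** With its last index lowered, the curvature form of a metric connection is
    skew-symmetric, so on a surface it has a single independent coefficient,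
    K det g; the indices are then raised again with the cofactor formula for the
    inverse of g. *)
Lemma curv_form_surface (K : A) :
  K * (g 0 0 * g 1 1 - g 0 1 ^+ 2) =
    \sum_l ariemann D half g q l 1 0 1 * g l 0 ->
  forall l i k p,
  Om l i k p = K * ((p == l)%:R * g i k - (p == i)%:R * g l k).
Proof.
move=> KE.
have skew a b : (Om 0 1 *m g) a b = - (Om 0 1 *m g) b a.
  have /matrixP/(_ a b) := curv_form_skew 0 1 (conn_form_metric D halfE gT gq).
  rewrite mxE [X in _ + X](_ : _ = (Om 0 1 *m g) b a).
    by rewrite [RHS]mxE => /eqP; rewrite addr_eq0 => /eqP.
  have -> : (Om 0 1 *m g) b a = (Om 0 1 *m g)^T a b by rewrite [RHS]mxE.
  by rewrite trmx_mul gT.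
have diag a : (Om 0 1 *m g) a a = 0.
  have := congr1 (fun x => half * (x + (Om 0 1 *m g) a a)) (skew a a).
  by rewrite /= addNr mulr0 mulrDr -mulrDl halfE mul1r.
have E10 : (Om 0 1 *m g) 1 0 = K * (g 0 0 * g 1 1 - g 0 1 ^+ 2).
  by rewrite KE mxE; apply: eq_bigr => l _; rewrite ariemannE.
have OmE k p : Om 0 1 k p = (Om 0 1 *m g) k 0 * q 0 p + (Om 0 1 *m g) k 1 * q 1 p.
  transitivity ((Om 0 1 *m g *m q) k p); first by rewrite -mulmxA gq mulmx1.
  by rewrite [LHS]mxE sum_ord2.
(* the entries of q *m g, kept folded to be used as linear combinations *)
pose T i j := q i 0 * g 0 j + q i 1 * g 1 j.
have TE i j : T i j = (i == j)%:R by exact: qgE.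
have q00 : (g 0 0 * g 1 1 - g 0 1 ^+ 2) * q 0 0 = g 1 1.
  transitivity (g 1 1 * T 0 0 - g 0 1 * T 0 1); last by rewrite !TE /=; ring.
  by rewrite /T (gC 1 0); ring.
have q01 : (g 0 0 * g 1 1 - g 0 1 ^+ 2) * q 0 1 = - g 0 1.
  transitivity (g 0 0 * T 0 1 - g 0 1 * T 0 0); last by rewrite !TE /=; ring.
  by rewrite /T (gC 1 0); ring.
have q11 : (g 0 0 * g 1 1 - g 0 1 ^+ 2) * q 1 1 = g 0 0.
  transitivity (g 0 0 * T 1 1 - g 0 1 * T 1 0); last by rewrite !TE /=; ring.
  by rewrite /T (gC 1 0); ring.
have Om01 k p : Om 0 1 k p = K * ((p == 0)%:R * g 1 k - (p == 1)%:R * g 0 k).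
  rewrite OmE; case: (ord2P k) => ->; rewrite ?diag ?(skew 0) E10 mul0r.
  - rewrite add0r mulNr -mulrA; case: (ord2P p) => ->.
    + by rewrite (qC 1 0) q01 (gC 1 0) /=; ring.
    + by rewrite q11 /=; ring.
  - rewrite addr0 -mulrA; case: (ord2P p) => ->.
    + by rewrite q00 /=; ring.
    + by rewrite q01 /=; ring.
move=> l i k p; case: (ord2P l) => ->; case: (ord2P i) => ->.
- by rewrite /curv_form !mxE; ring.
- exact: Om01.
- by rewrite curv_formC mxE Om01; ring.
- by rewrite /curv_form !mxE; ring.
Qed.

Variables (S : 'M[A]_2) (t : A).
Hypothesis ST : S^T = S.
Local Notation N := (anabla2 D half g q S).
Local Notation NN := (anabla_nabla2 D half g q S).
Local Notation H := (ahessian D half g q t).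
Hypothesis trS : \sum_a \sum_b q a b * S a b = t.
Hypothesis div0 : forall j, \sum_a \sum_b q a b * N a b j = 0.

Let SC i j : S i j = S j i. Proof. by rewrite -[in LHS]ST mxE. Qed.

Let NC k i j : N k i j = N k j i.
Proof.
rewrite /anabla2 SC; congr (_ - _); apply: eq_bigr => p _.
by rewrite (SC p j) (SC i p) addrC.
Qed.

(** The second term on the right contracts to the divergence of S. *)
Lemma codazzi_trace k :
  D k t = \sum_a \sum_b q a b * (N k a b - N a k b).
Proof.
have -> : D k t = \sum_a \sum_b q a b * N k a b.
  by rewrite -trS; exact: (der_contract D halfE gT gq).
rewrite -[LHS]subr0 -[X in _ - X](div0 k) -sumrB; apply: eq_bigr => a _.
by rewrite -sumrB; apply: eq_bigr => b _; rewrite (NC a b k) -mulrBr.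
Qed.

(** Only k != i matters, so the alternating part of the covariant derivative of
    S is given by one covector C; [codazzi_trace] computes its raised components
    and lowering the index recovers C. *)
Lemma codazzi k i j : N k i j = N i k j + g i j * D k t - g k j * D i t.
Proof.
pose C b := N 0 1 b - N 1 0 b.
have t0 : D 0 t = q 1 0 * C 0 + q 1 1 * C 1.
  by rewrite codazzi_trace !sum_ord2 /C; ring.
have t1 : D 1 t = - (q 0 0 * C 0 + q 0 1 * C 1).
  by rewrite codazzi_trace !sum_ord2 /C; ring.
have CE b : C b = g b 1 * D 0 t - g b 0 * D 1 t.
  have gqE i' j' : g i' 0 * q 0 j' + g i' 1 * q 1 j' = (i' == j')%:R.
    by have /matrixP/(_ i' j') := gq; rewrite !mxE sum_ord2.
  have : C b = (b == 0)%:R * C 0 + (b == 1)%:R * C 1.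
    by case: (ord2P b) => ->; rewrite ?eqxx /=; ring.
  by rewrite -!gqE t0 t1 => ->; ring.
have {}CE b : N 0 1 b = N 1 0 b + (g b 1 * D 0 t - g b 0 * D 1 t).
  by rewrite -CE /C; ring.
case: (ord2P k) => ->; case: (ord2P i) => ->.
- ring.
- by rewrite CE !(gC j); ring.
- by rewrite CE !(gC j); ring.
- ring.
Qed.

(** The metric is parallel, so differentiating the Codazzi equation only
    differentiates S and dt. *)
Lemma codazzi_derivative l k i j :
  NN l k i j = NN l i k j + g i j * H l k - g k j * H l i.
Proof.
have Dg a b c : D a (g b c) =
    \sum_p (Gamma D half g q p a b * g p c + Gamma D half g q p a c * g b p).
  exact: der_metric.
rewrite /anabla_nabla2 /ahessian [N k i j]codazzi.
rewrite raddfB raddfD !derM !Dg.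
under [X in _ - X = _]eq_bigr => p _ do
  rewrite (codazzi p) (codazzi k p) (codazzi k i).
rewrite !sum_ord2; ring.
Qed.

(** Tracing [codazzi_derivative] over l and k, the term with l and i in the
    wrong order is exchanged by the Ricci identity and becomes the derivative of
    the divergence. *)
Lemma arough_laplacian_surface (K : A) :
  K * (g 0 0 * g 1 1 - g 0 1 ^+ 2) =
    \sum_l ariemann D half g q l 1 0 1 * g l 0 ->
  forall i j,
  - \sum_l \sum_k q l k * NN l k i j =
    - (K + K) * S i j + H i j + (K * t + alaplacian D half g q t) * g i j.
Proof.
move=> KE i j; rewrite (alaplacianE D halfE gT gq).
have divD : \sum_l \sum_k q l k * NN i l k j = 0.
  transitivity (D i (\sum_l \sum_k q l k * N l k j)
      - \sum_p Gamma D half g q p i j * \sum_l \sum_k q l k * N l k p); last first.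
    rewrite div0 raddf0 sub0r big1 ?oppr0// => p _.
    by rewrite div0 mulr0.
  rewrite (der_contract D halfE gT gq i (fun l k => N l k j)) /anabla_nabla2.
  by rewrite !sum_ord2; ring.
have curvE l k : NN l i k j = NN i l k j
    - K * (g i k * S l j - g l k * S i j + g i j * S k l - g l j * S k i).
  have OmS : (Om l i *m S) k j = K * (g i k * S l j - g l k * S i j).
    rewrite mxE sum_ord2 !(curv_form_surface KE).
    by case: (ord2P l) => ->; case: (ord2P i) => -> /=; ring.
  have SOm : (S *m (Om l i)^T) k j = K * (g i j * S k l - g l j * S k i).
    have trE a b : (Om l i)^T a b = Om l i b a by rewrite mxE.
    rewrite mxE sum_ord2 !trE !(curv_form_surface KE).
    by case: (ord2P l) => ->; case: (ord2P i) => -> /=; ring.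
  rewrite -[LHS](subrK (NN i l k j)) (ricci_identity D half q gT) [LHS]addrC.
  congr (_ + _); rewrite mxE OmS SOm; ring.
have contr (X : 'I_2 -> A) b : \sum_l \sum_k q l k * (g b k * X l) = X b.
  rewrite !sum_ord2 !(gC b).
  transitivity ((q 0 0 * g 0 b + q 0 1 * g 1 b) * X 0
    + (q 1 0 * g 0 b + q 1 1 * g 1 b) * X 1); first by ring.
  by rewrite !qgE; case: (ord2P b) => -> /=; ring.
have trg : \sum_l \sum_k q l k * g l k = 1 + 1.
  transitivity ((q 0 0 * g 0 0 + q 0 1 * g 1 0) + (q 1 0 * g 0 1 + q 1 1 * g 1 1)).
    by rewrite !sum_ord2 (gC 1 0); ring.
  by rewrite !qgE.
have split l k : q l k * NN l k i j =
    q l k * NN i l k j + g i j * (q l k * H l k) - q l k * (g j k * H l i)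
    - K * (q l k * (g i k * S l j)) + K * S i j * (q l k * g l k)
    - K * g i j * (q l k * S l k) + K * (q k l * (g j l * S k i)).
  by rewrite codazzi_derivative curvE (qC k l) (gC j l) (gC k j) (SC k l); ring.
transitivity (- (\sum_l \sum_k q l k * NN i l k j
  + g i j * (\sum_l \sum_k q l k * H l k)
  - \sum_l \sum_k q l k * (g j k * H l i)
  - K * (\sum_l \sum_k q l k * (g i k * S l j))
  + K * S i j * (\sum_l \sum_k q l k * g l k)
  - K * g i j * (\sum_l \sum_k q l k * S l k)
  + K * (\sum_k \sum_l q k l * (g j l * S k i)))).
  rewrite !sum_ord2 !split; ring.
rewrite divD trg trS !contr (ahessianC D half q gT t j i) (SC j i); ring.
Qed.

End Surface.

(** * The biharmonic stress-energy tensor *)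

(** Here h is the metric and w the connection of a bundle of rank n, and phi k
    is the derivative of the map in direction k, a section of the bundle. *)
Section Bienergy.
Variables (m n : nat) (A : comPzRingType) (D : derivations m A).
Implicit Types (i j k l p : 'I_m).
Variables (half : A) (g q : 'M[A]_m) (h : 'M[A]_n).
Variables (w : 'I_m -> 'M[A]_n) (phi : 'I_m -> 'rV[A]_n).
Local Notation Gamma := (Gamma D half g q).
Local Notation cov := (cov D w).

Definition second_form i j : 'rV[A]_n := cov i (phi j) - \sum_k Gamma k i j *: phi k.
Definition atension : 'rV[A]_n := agtrace q second_form.
Definition nabla_pb2 (s : 'rV[A]_n) i j : 'rV[A]_n :=
  cov i (cov j s) - \sum_k Gamma k i j *: cov k s.
Definition atension_sqnorm : A := inner h atension atension.
Definition dphi_nabla_tau i j : A := inner h (phi i) (cov j atension).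
Definition astress : 'M[A]_m := \matrix_(i, j)
  ((atension_sqnorm * half + \sum_a \sum_b q a b * dphi_nabla_tau a b) * g i j
   - dphi_nabla_tau i j - dphi_nabla_tau j i).

Hypothesis (halfE : half + half = 1) (gT : g^T = g) (gq : g *m q = 1%:M).
Hypothesis (hT : h^T = h) (wh : metric_connection D w h).
Hypothesis phi_torsion : forall i j, cov i (phi j) = cov j (phi i).

Let gC i j : g i j = g j i. Proof. by rewrite -[in LHS]gT mxE. Qed.
Let qC i j : q i j = q j i.
Proof. by rewrite -[in LHS](metric_qT gT gq) mxE. Qed.

Lemma astressT : astress^T = astress.
Proof. by apply/matrixP => i j; rewrite !mxE (gC j i) addrAC. Qed.

Lemma metric_trace : \sum_i \sum_j q i j * g i j = m%:R.
Proof.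
transitivity (\tr (q *m g)); last by rewrite (metric_qg gq) mxtrace1.
apply: eq_bigr => i _; rewrite mxE; apply: eq_bigr => j _; by rewrite gC.
Qed.

(** The factor m comes from the trace of the metric; the coefficient of
    < d phi, nabla tau > vanishes for surfaces. *)
Lemma astress_trace :
  \sum_i \sum_j q i j * astress i j =
  m%:R * half * atension_sqnorm
  + (m%:R - 1 - 1) * \sum_a \sum_b q a b * dphi_nabla_tau a b.
Proof.
set e := \sum_a \sum_b _ * dphi_nabla_tau _ _.
have eT : \sum_a \sum_b q a b * dphi_nabla_tau b a = e.
  rewrite exchange_big; apply: eq_bigr => a _; apply: eq_bigr => b _.
  by rewrite qC.
transitivity ((atension_sqnorm * half + e) * \sum_i \sum_j q i j * g i j - e
   - \sum_a \sum_b q a b * dphi_nabla_tau b a); last first.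
  by rewrite eT metric_trace; ring.
rewrite mulr_sumr -!sumrB; apply: eq_bigr => a _.
rewrite mulr_sumr -!sumrB; apply: eq_bigr => b _.
rewrite mxE -/e; ring.
Qed.

Lemma second_formC i j : second_form i j = second_form j i.
Proof.
rewrite /second_form phi_torsion; congr (_ - _); apply: eq_bigr => k _.
by rewrite GammaC.
Qed.

Lemma dphi_nabla_tau_cov k i j :
  D k (dphi_nabla_tau i j)
  - \sum_p (Gamma p k i * dphi_nabla_tau p j + Gamma p k j * dphi_nabla_tau i p) =
  inner h (second_form k i) (cov j atension) + inner h (phi i) (nabla_pb2 atension k j).
Proof.
rewrite /second_form /nabla_pb2 innerDl innerNl innerDr innerNr inner_suml inner_sumr.
under [X in _ = _ - X + _]eq_bigr => p _ do rewrite innerZl.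
under [X in _ = _ + (_ - X)]eq_bigr => p _ do rewrite innerZr.
rewrite {1}/dphi_nabla_tau (der_inner k _ _ wh) big_split /= /dphi_nabla_tau; ring.
Qed.

(** The derivative of |tau|^2 / 2 cancels against the trace of the second
    fundamental form, and two contractions of the second fundamental form with
    nabla tau cancel by symmetry.  What remains of the second derivatives of tau
    is a commutator and their trace. *)
Lemma astress_divergence j :
  \sum_i \sum_k q i k * anabla2 D half g q astress i k j =
  \sum_i \sum_k q i k * inner h (phi i) (atension *m curv_form D w j k)
  - inner h (phi j) (agtrace q (nabla_pb2 atension)).
Proof.
pose W := dphi_nabla_tau.
pose dW k a b := inner h (second_form k a) (cov b atension)
  + inner h (phi a) (nabla_pb2 atension k b).
pose f := atension_sqnorm * half + \sum_a \sum_b q a b * W a b.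
have Df : D j f = inner h atension (cov j atension) + \sum_a \sum_b q a b * dW j a b.
  rewrite raddfD /= (der_contract D halfE gT gq).
  congr (_ + _).
    rewrite derM (der_half D _ halfE) mulr0 addr0 (der_inner j _ _ wh).
    by rewrite (innerC (cov j atension) _ hT) -[RHS]mulr1 -halfE; ring.
  by apply: eq_bigr => a _; apply: eq_bigr => b _; rewrite dphi_nabla_tau_cov.
have dS k a b : anabla2 D half g q astress k a b = D k f * g a b - dW k a b - dW k b a.
  rewrite /dW -!dphi_nabla_tau_cov /anabla2.
  have SE x y : astress x y = f * g x y - W x y - W y x by rewrite mxE.
  under [in LHS]eq_bigr => p _ do rewrite !SE.
  rewrite SE !raddfB derM (der_metric D halfE gT gq) /=.
  have -> : \sum_p (Gamma p k a * (f * g p b - W p b - W b p)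
                    + Gamma p k b * (f * g a p - W a p - W p a)) =
    f * (\sum_p (Gamma p k a * g p b + Gamma p k b * g a p))
    - \sum_p (Gamma p k a * W p b + Gamma p k b * W a p)
    - \sum_p (Gamma p k b * W p a + Gamma p k a * W b p).
    by rewrite mulr_sumr -!sumrB; apply: eq_bigr => p _; ring.
  rewrite /W; ring.
have cov2B b : nabla_pb2 atension j b - nabla_pb2 atension b j
    = atension *m curv_form D w j b.
  rewrite /nabla_pb2 -[RHS](cov_commutator D w j b) opprD opprK addrACA.
  rewrite [X in _ + X](_ : _ = 0) ?addr0// addrC -sumrB big1 // => p _.
  by rewrite (GammaC D half q gT) subrr.
pose X := \sum_i \sum_k q i k * inner h (phi i) (nabla_pb2 atension k j).
pose Y := \sum_i \sum_k q i k * inner h (second_form j i) (cov k atension).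
pose X' := \sum_i \sum_k q i k * inner h (phi i) (nabla_pb2 atension j k).
have Df' : D j f = inner h atension (cov j atension) + (Y + X').
  rewrite Df; congr (_ + _); rewrite -big_split; apply: eq_bigr => a _.
  by rewrite -big_split; apply: eq_bigr => b _; rewrite mulrDr.
transitivity (X' - X - inner h (phi j) (agtrace q (nabla_pb2 atension))); last first.
  congr (_ - _); rewrite -sumrB; apply: eq_bigr => a _.
  rewrite -sumrB; apply: eq_bigr => b _.
  by rewrite -cov2B innerDr innerNr mulrBr.
have E0 : \sum_i \sum_k q i k * (D i f * g k j) = D j f.
  transitivity (\sum_i (q *m g) i j * D i f).
    apply: eq_bigr => i _; rewrite mxE mulr_suml; apply: eq_bigr => k _; ring.
  rewrite (metric_qg gq) (bigD1 j) //= mxE eqxx mul1r big1 ?addr0// => i ij.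
  by rewrite mxE (negPf ij) mul0r.
have E1 : \sum_i \sum_k q i k * inner h (second_form i k) (cov j atension)
    = inner h atension (cov j atension).
  rewrite {3}/atension /agtrace inner_suml; apply: eq_bigr => i _.
  by rewrite inner_suml; apply: eq_bigr => k _; rewrite innerZl.
have E2 : \sum_i \sum_k q i k * inner h (phi k) (nabla_pb2 atension i j) = X.
  rewrite exchange_big; apply: eq_bigr => k _; apply: eq_bigr => i _.
  by rewrite qC.
have E3 : \sum_i \sum_k q i k * inner h (phi j) (nabla_pb2 atension i k)
    = inner h (phi j) (agtrace q (nabla_pb2 atension)).
  rewrite /agtrace inner_sumr; apply: eq_bigr => i _.
  by rewrite inner_sumr; apply: eq_bigr => k _; rewrite innerZr.
transitivity (D j f - inner h atension (cov j atension) - X - Y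
    - inner h (phi j) (agtrace q (nabla_pb2 atension))); last by rewrite Df'; ring.
rewrite -E0 -E1 -E2 -E3 -!sumrB; apply: eq_bigr => i _.
rewrite -!sumrB; apply: eq_bigr => k _.
rewrite dS /dW (second_formC i j); ring.
Qed.

(** [Rm u v s] stands for R(u, v) s, the curvature of the target; the second
    hypothesis on it is the pair symmetry of the curvature tensor combined with
    its two skew symmetries. *)
Lemma astress_divergence_bitension
    (Rm : 'rV[A]_n -> 'rV[A]_n -> 'rV[A]_n -> 'rV[A]_n) :
  (forall i j s, s *m curv_form D w i j = Rm (phi i) (phi j) s) ->
  (forall a b c e, inner h a (Rm b c e) = inner h b (Rm a e c)) ->
  forall j, \sum_i \sum_k q i k * anabla2 D half g q astress i k j =
  - inner h (phi j) (agtrace q (nabla_pb2 atension)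
                     - agtrace q (fun i k => Rm (phi i) atension (phi k))).
Proof.
move=> curvR RmC j; rewrite astress_divergence innerDr innerNr opprB; congr (_ - _).
rewrite /agtrace inner_sumr; apply: eq_bigr => i _.
by rewrite inner_sumr; apply: eq_bigr => k _; rewrite innerZr curvR RmC.
Qed.
End Bienergy.

(** * The pair symmetry of the curvature *)

Section PairSymmetry.
Variables (m : nat) (A : comPzRingType) (D : derivations m A).
Implicit Types (i j k l p : 'I_m).
Variables (half : A) (g q : 'M[A]_m).
Hypothesis (halfE : half + half = 1) (gT : g^T = g) (gq : g *m q = 1%:M).

Lemma first_bianchi l k i j :
  ariemann D half g q l k i j + ariemann D half g q l i j k
  + ariemann D half g q l j k i = 0.
Proof.
rewrite /ariemann.
set s1 := (X in _ + X + _ + _); set s2 := (X in _ + _ + (_ + X) + _).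
set s3 := (X in _ + _ + _ + (_ + X)).
have s0 : s1 + s2 + s3 = 0.
  rewrite /s1 /s2 /s3 -!big_split big1 //= => p _.
  rewrite (GammaC D half q gT p j k) (GammaC D half q gT p i k) (GammaC D half q gT p j i).
  ring.
rewrite (GammaC D half q gT l j k) (GammaC D half q gT l i k) (GammaC D half q gT l j i).
rewrite -[RHS]s0; ring.
Qed.

(** The classical octahedron argument: an alternating sum of four instances of
    the first Bianchi identity reduces, by the two skew symmetries, to twice the
    difference of the two sides. *)
Lemma curv_form_pair_symmetry i j k l :
  (curv_form D (conn_form D half g q) i j *m g) k l =
  (curv_form D (conn_form D half g q) l k *m g) j i.
Proof.
pose F l k i j := (curv_form D (conn_form D half g q) i j *m g) k l.
have F1 l' k' i' j' : F l' k' i' j' = - F l' k' j' i'.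
  by rewrite /F curv_formC mulNmx mxE.
have F2 l' k' i' j' : F l' k' i' j' = - F k' l' i' j'.
  have := curv_form_skew i' j' (conn_form_metric D halfE gT gq).
  have -> : g *m (curv_form D (conn_form D half g q) i' j')^T
          = (curv_form D (conn_form D half g q) i' j' *m g)^T by rewrite trmx_mul gT.
  by move=> /matrixP/(_ k' l'); rewrite !mxE => /eqP; rewrite addr_eq0 => /eqP;
    rewrite /F !mxE.
have B l' k' i' j' : F l' k' i' j' + F l' i' j' k' + F l' j' k' i' = 0.
  rewrite /F !mxE -!big_split big1 //= => p _.
  by rewrite -!mulrDl -!ariemannE first_bianchi mul0r.
suff : F l k i j = F i j l k by [].
rewrite -[LHS]mul1r -[RHS]mul1r -halfE.
have e : (F l k i j + F l i j k + F l j k i) - (F k i j l + F k j l i + F k l i j)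
   - (F i j l k + F i l k j + F i k j l) + (F j l k i + F j k i l + F j i l k) = 0.
  by rewrite !B; ring.
rewrite (F2 k l) (F2 k j l i) (F1 j k l i) (F2 i l k j) (F1 l i k j) (F2 i k)
   (F2 j l) (F2 j i) in e.
rewrite -[RHS]addr0 -(mulr0 half) -e; ring.
Qed.
End PairSymmetry.

(** * The pull-back of a Levi-Civita connection *)

(** The ring morphism psi plays the role of the composition with a map, whose
    coordinate functions are the entries of Phi. *)
Section PullBack.
Variables (m n : nat) (A B : comPzRingType).
Variables (D : derivations m A) (DB : derivations n B).
Variables (psi : {rmorphism B -> A}) (Phi : 'rV[A]_n).
Hypothesis chain_rule : forall k b, D k (psi b) = \sum_c D k (Phi 0 c) * psi (DB c b).
Variables (half : B) (h q : 'M[B]_n).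
Hypothesis (halfE : half + half = 1) (hT : h^T = h) (hq : h *m q = 1%:M).
Implicit Types i j k : 'I_m.
Local Notation Gam := (conn_form DB half h q).
Local Notation RB := (curv_form DB Gam).

Definition differential k : 'rV[A]_n := map_mx (D k) Phi.

Definition pullback_conn k : 'M[A]_n := \sum_b differential k 0 b *: map_mx psi (Gam b).

Definition pullback_curvature (u v s : 'rV[A]_n) : 'rV[A]_n :=
  s *m \sum_b \sum_c (u 0 b * v 0 c) *: map_mx psi (RB b c).

Lemma der_mx_pullback k p r (M : 'M[B]_(p, r)) :
  map_mx (D k) (map_mx psi M) = \sum_b differential k 0 b *: map_mx psi (map_mx (DB b) M).
Proof.
apply/matrixP => x y; rewrite summxE !mxE chain_rule.
by apply: eq_bigr => b _; rewrite !mxE.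
Qed.

(** The pull-back connection is torsion free because the Levi-Civita connection
    of the target is; this is the symmetry of the second fundamental form. *)
Lemma pullback_torsion i j :
  cov D pullback_conn i (differential j) = cov D pullback_conn j (differential i).
Proof.
rewrite /cov /differential der_mxC; congr (_ + _); apply/matrixP => x a.
rewrite !mxE /pullback_conn.
under eq_bigr => c _ do rewrite summxE mulr_sumr.
under [RHS]eq_bigr => c _ do rewrite summxE mulr_sumr.
rewrite exchange_big; apply: eq_bigr => b _; apply: eq_bigr => c _.
by rewrite !mxE (GammaC DB half q hT a b c) ord1; ring.
Qed.

Lemma pullback_metric : metric_connection D pullback_conn (map_mx psi h).
Proof.
move=> k; rewrite der_mx_pullback /pullback_conn mulmx_suml.
rewrite [X in _ + _ *m X](_ : _ = \sum_b differential k 0 b *: (map_mx psi (Gam b))^T).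
  rewrite mulmx_sumr -big_split; apply: eq_bigr => b _.
  rewrite (conn_form_metric DB halfE hT hq) map_mxD !map_mxM scalerDr.
  by rewrite -scalemxAl -scalemxAr map_trmx.
apply/matrixP => x y; rewrite !summxE mxE summxE; apply: eq_bigr => b _.
by rewrite !mxE.
Qed.

(** The second derivatives of Phi enter symmetrically and cancel; the rest is
    the curvature of the target evaluated on the differential. *)
Lemma pullback_curv_form i j :
  curv_form D pullback_conn i j =
  \sum_b \sum_c (differential i 0 b * differential j 0 c) *: map_mx psi (RB b c).
Proof.
have dw k l : map_mx (D k) (pullback_conn l) =
   \sum_c map_mx (D k) (map_mx (D l) Phi) 0 c *: map_mx psi (Gam c) +
   \sum_b \sum_c (differential k 0 b * differential l 0 c)
     *: map_mx psi (map_mx (DB b) (Gam c)).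
  rewrite exchange_big -big_split raddf_sum; apply: eq_bigr => c _.
  apply/matrixP => x y; rewrite !mxE derM chain_rule summxE mulr_sumr; congr (_ + _).
  by apply: eq_bigr => b _; rewrite !mxE; ring.
have ww k l : pullback_conn k *m pullback_conn l =
   \sum_b \sum_c (differential l 0 b * differential k 0 c) *: map_mx psi (Gam c *m Gam b).
  rewrite {2}/pullback_conn mulmx_sumr; apply: eq_bigr => b _.
  rewrite mulmx_suml; apply: eq_bigr => c _.
  by rewrite -scalemxAl -scalemxAr scalerA map_mxM mulrC.
have sw (F : 'I_n -> 'I_n -> 'M[A]_n) k l :
   \sum_b \sum_c (differential k 0 b * differential l 0 c) *: F b c =
   \sum_b \sum_c (differential l 0 b * differential k 0 c) *: F c b.
  rewrite exchange_big; apply: eq_bigr => b _; apply: eq_bigr => c _.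
  by rewrite mulrC.
rewrite /curv_form !dw !ww (der_mxC D j i) opprD addrACA subrr add0r.
rewrite [X in _ - X + _ - _]sw [X in _ - X]sw.
rewrite -sumrB -big_split /= -sumrB; apply: eq_bigr => b _.
rewrite -sumrB -big_split /= -sumrB; apply: eq_bigr => c _.
rewrite -scalerBr -scalerDr -scalerBr; congr (_ *: _).
by apply/matrixP => x y; rewrite !mxE !(raddfB, raddfD).
Qed.

Lemma pullback_curvature_pair_symmetry a b c e :
  inner (map_mx psi h) a (pullback_curvature b c e) =
  inner (map_mx psi h) b (pullback_curvature a e c).
Proof.
pose F b' c' (k l : 'I_n) := psi ((RB b' c' *m h) k l).
have key u v s t : inner (map_mx psi h) u (pullback_curvature v s t) =
    \sum_i \sum_j \sum_l \sum_k v 0 i * s 0 j * (t 0 k * F i j k l * u 0 l).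
  rewrite innerC ?map_trmx ?hT// /inner /pullback_curvature.
  rewrite mulmx_sumr !mulmx_suml summxE; apply: eq_bigr => i _.
  rewrite mulmx_sumr !mulmx_suml summxE; apply: eq_bigr => j _.
  rewrite -scalemxAr -!scalemxAl -(mulmxA t) -map_mxM !mxE mulr_sumr.
  apply: eq_bigr => l _; rewrite !mxE -mulr_sumr -mulr_suml; congr (_ * (_ * _)).
  by apply: eq_bigr => k _; rewrite mxE.
rewrite !key.
have exch (G : 'I_n -> 'I_n -> 'I_n -> 'I_n -> A) :
    \sum_i \sum_j \sum_l \sum_k G i j l k = \sum_l \sum_k \sum_i \sum_j G i j l k.
  under eq_bigr => i _ do rewrite exchange_big /=.
  rewrite exchange_big /=; apply: eq_bigr => l _.
  under eq_bigr => i _ do rewrite exchange_big /=.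
  by rewrite exchange_big.
rewrite exch; apply: eq_bigr => l _; apply: eq_bigr => k _.
apply: eq_bigr => i _; apply: eq_bigr => j _.
by rewrite /F (curv_form_pair_symmetry DB halfE hT hq); ring.
Qed.
End PullBack.

(** * Young's theorem *)

Section NearEqual.
Context {R : realType} {V W : normedModType R}.
Implicit Types f g : V -> W.

(** The differential of f also serves as the differential of g. *)
Lemma near_eq_differentiable f g x :
  (\near x, f x = g x) -> differentiable f x -> differentiable g x.
Proof.
move=> fg df.
have gE : g \o shift x = cst (g x) + 'd f x +o_ 0 id.
  have fgx : f x = g x by exact: nbhs_singleton fg.
  apply/eqaddoP => e e0; have /eqaddoP/(_ _ e0) := diff_locally df.
  have fg0 : \forall h \near (0 : V), f (h + x) = g (h + x).
    by move: fg; rewrite (near_shift 0 x)/= subr0.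
  by move=> H; apply: filterS2 fg0 H => y fgy; rewrite !fctE /= -fgx -fgy.
have dE := diff_unique (diff_continuous df) gE.
by apply/diff_locallyP; rewrite dE; split => //; exact: diff_continuous.
Qed.
End NearEqual.

Section Young.
Context {R : realType} {V : normedModType R}.
Implicit Types (f : V -> R) (x u v : V).

Lemma is_derive_line f u y (s : R) :
  derivable f (s *: u + y) u ->
  is_derive s 1 (fun s => f (s *: u + y)) ('D_u f (s *: u + y)).
Proof.
have E : (fun h : R => h^-1 *: (f ((h *: (1 : R) + s) *: u + y) - f (s *: u + y))) =
  (fun h => h^-1 *: (f (h *: u + (s *: u + y)) - f (s *: u + y))).
  by apply/funext => h; rewrite [h *: (1 : R)]mulr1 scalerDl addrA.
move=> df; apply: DeriveDef; first by rewrite /derivable E.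
by rewrite /derive E.
Qed.

Definition mixed_difference f x u v (t : R) : R :=
  f (t *: u + (t *: v + x)) - f (t *: u + x) - f (t *: v + x) + f x.

Lemma mixed_differenceC f x u v t :
  mixed_difference f x u v t = mixed_difference f x v u t.
Proof. by rewrite /mixed_difference addrCA; ring. Qed.

(** By the mean value theorem in direction u, the mixed difference is t times an
    increment of D_u f, and the differentiability of D_u f at x makes that
    increment t D_v D_u f (x) up to o(t). *)
Lemma mixed_difference_approx f x u v (e : R) : 0 < e ->
  (\near x, differentiable f x) -> differentiable ('D_u f) x ->
  \forall t \near 0^'+,
    `|mixed_difference f x u v t - t ^+ 2 * 'D_v ('D_u f) x| <= e * t ^+ 2.
Proof.
move=> e0 nf dk; set k := 'D_u f.
pose C := `|u| + `|v| + 1.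
have C0 : 0 < C by rewrite ltr_wpDl// addr_ge0.
(* two errors of size e' t C are made, each of them multiplied by t *)
pose e' := e / (2 * C).
have e'0 : 0 < e' by rewrite divr_gt0// mulr_gt0.
have /eqaddoP/(_ _ e'0) := diff_locally dk.
move=> /nbhs_ballP[d1 /= d10 Hd1].
have {}nf : \forall h \near (0 : V), differentiable f (h + x).
  by move: nf; rewrite (near_shift 0 x)/= subr0.
move/nbhs_ballP : nf => [d2 /= d20 Hd2].
have sm (a b t : R) : 0 <= a -> a <= t -> 0 <= b -> b <= t ->
   `|a *: u + b *: v| <= t * C.
  move=> a0 at' b0 bt; apply: (le_trans (ler_normD _ _)).
  rewrite !normrZ !ger0_norm//.
  have u0 : 0 <= `|u| by []. have v0 : 0 <= `|v| by [].
  rewrite /C; nra.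
near=> t.
have t0 : 0 < t by [].
have tC1 : t * C < d1.
  by rewrite -ltr_pdivlMr//; near: t; apply: nbhs_right_lt; rewrite divr_gt0.
have tC2 : t * C < d2.
  by rewrite -ltr_pdivlMr//; near: t; apply: nbhs_right_lt; rewrite divr_gt0.
have kE (a b : R) : 0 <= a -> a <= t -> 0 <= b -> b <= t ->
    `|k (a *: u + (b *: v + x)) - (k x + a * 'd k x u + b * 'd k x v)| <= e' * (t * C).
  move=> a0 at' b0 bt; have le := sm _ _ _ a0 at' b0 bt.
  have := Hd1 (a *: u + b *: v); rewrite -ball_normE /= sub0r normrN.
  have LE : 'd k x (a *: u + b *: v) = a * 'd k x u + b * 'd k x v.
    by rewrite linearD; congr (_ + _); exact: linearZ.
  move=> /(_ (le_lt_trans le tC1)).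
  rewrite !fctE/= LE -[a *: u + _ + _]addrA [k x + (_ + _)]addrA.
  by move=> /le_trans; apply; rewrite ler_pM2l.
have df (a b : R) : 0 <= a -> a <= t -> 0 <= b -> b <= t ->
    derivable f (a *: u + (b *: v + x)) u.
  move=> a0 at' b0 bt; have le := sm _ _ _ a0 at' b0 bt.
  rewrite addrA; apply/diff_derivable/Hd2.
  by rewrite -ball_normE /= sub0r normrN (le_lt_trans le).
pose G s := f (s *: u + (t *: v + x)) - f (s *: u + (0 *: v + x)).
have dG s : 0 <= s -> s <= t ->
   is_derive s 1 G (k (s *: u + (t *: v + x)) - k (s *: u + (0 *: v + x))).
  move=> s0 st; apply: is_deriveB; apply: is_derive_line; apply: df => //; exact: ltW.
have GE : mixed_difference f x u v t = G t - G 0.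
  by rewrite /mixed_difference /G !scale0r !add0r; ring.
have [c ct GtE] : exists2 c, c \in `]0, t[ & G t - G 0 =
    (k (c *: u + (t *: v + x)) - k (c *: u + (0 *: v + x))) * (t - 0).
  apply: (MVT t0).
    by move=> s; rewrite in_itv /= => /andP[s0 st]; apply: dG; exact: ltW.
  apply: derivable_within_continuous => s; rewrite in_itv /= => /andP[s0 st].
  by have [] := dG s s0 st.
rewrite in_itv /= in ct; case/andP: ct => /ltW c0 /ltW ct.
rewrite GE GtE subr0 deriveE//.
have := kE c t c0 ct (ltW t0) (lexx t); have := kE c 0 c0 ct (lexx 0) (ltW t0).
set k1 := k _; set k2 := k (_ + _); set Lu := 'd k x u; set Lv := 'd k x v => h1 h2.
have e'E : e * t ^+ 2 = (e' * (t * C) + e' * (t * C)) * t.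
  by rewrite /e'; field; rewrite gt_eqF.
have -> : (k2 - k1) * t - t ^+ 2 * Lv =
  ((k2 - (k x + c * Lu + t * Lv)) - (k1 - (k x + c * Lu + 0 * Lv))) * t by ring.
rewrite normrM (gtr0_norm t0) e'E ler_pM2r//.
by apply: (le_trans (ler_normB _ _)); rewrite lerD.
Unshelve. all: by end_near. Qed.

(** The mixed difference is symmetric in u and v, so both iterated derivatives
    are its limit after division by t^2. *)
Lemma young f x u v :
  (\near x, differentiable f x) ->
  differentiable ('D_u f) x -> differentiable ('D_v f) x ->
  'D_v ('D_u f) x = 'D_u ('D_v f) x.
Proof.
move=> nf du dv; apply/eqP; rewrite -subr_eq0 -normr_le0; apply/ler_addgt0Pl => e e0.
rewrite addr0.
have e20 : 0 < e / 2 by rewrite divr_gt0.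
have H1 := mixed_difference_approx v e20 nf du.
have H2 := mixed_difference_approx u e20 nf dv.
apply: (@filter_const _ (0 : R)^'+).
have F0 : Filter (0 : R)^'+ by exact: _.
apply: (@filterS3 _ _ F0 _ _ _ _ _ (nbhs_right_gt (0 : R)) H1 H2) => t t0 h1 h2.
have t20 : 0 < t ^+ 2 by rewrite exprn_gt0.
rewrite mixed_differenceC in h2.
rewrite -(ler_pM2r t20) -[X in _ * X](gtr0_norm t20) -normrM.
set a := 'D_v _ x in h1 *; set b := 'D_u _ x in h2 *.
set D := mixed_difference _ _ _ _ _ in h1 h2.
have -> : (a - b) * t ^+ 2 = (D - t ^+ 2 * b) - (D - t ^+ 2 * a) by ring.
have -> : e * t ^+ 2 = e / 2 * t ^+ 2 + e / 2 * t ^+ 2 by field.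
exact: le_trans (ler_normB _ _) (lerD h2 h1).
Qed.
End Young.

(** * Smooth functions on an open set *)

Section Ck.
Context {R : realType}.

(** Smoothness is closed under the operations by induction on the order of
    differentiation, which this truncated version makes possible: the Leibniz
    and chain rules express a derivative by functions that are smooth to one
    order less. *)
Definition Ck_on m (V : normedModType R) (N : nat) (U : set 'rV[R]_m)
  (f : 'rV[R]_m -> V) : Prop :=
  forall s : seq 'I_m, (size s <= N)%N -> forall x, U x ->
    differentiable (foldr (@partial R m V) f s) x.

Lemma smooth_onP m (V : normedModType R) (U : set 'rV[R]_m) (f : 'rV[R]_m -> V) :
  smooth_on U f <-> forall N, Ck_on N U f.
Proof.
split=> [fU N s _ x Ux|fU s x Ux]; first exact: fU.
exact: (fU (size s)).
Qed.

Section Domain.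
Context {m : nat} (U : set 'rV[R]_m).
Hypothesis oU : open U.

Section Vector.
Context {V : normedModType R}.
Implicit Types f g : 'rV[R]_m -> V.

Lemma Ck_onS N f : Ck_on N.+1 U f <->
  (forall x, U x -> differentiable f x) /\ forall k, Ck_on N U (partial k f).
Proof.
split=> [fU|[df fU] s].
  split=> [x Ux|k s sN x Ux]; first exact: (fU [::]).
  by have := fU (rcons s k); rewrite foldr_rcons size_rcons; apply.
case/lastP: s => [_|s k]; first exact: df.
by rewrite size_rcons foldr_rcons => sN x Ux; exact: fU.
Qed.

Lemma Ck_on0 f : Ck_on 0 U f <-> (forall x, U x -> differentiable f x).
Proof. by split=> [fU x Ux|fU [|//] _]; [exact: (fU [::])|exact: fU]. Qed.

Lemma Ck_on_differentiable N f x : Ck_on N U f -> U x -> differentiable f x.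
Proof. by move=> fU; exact: (fU [::]). Qed.

Lemma smooth_on_differentiable f x : smooth_on U f -> U x -> differentiable f x.
Proof. by move=> fU; exact: (fU [::]). Qed.

Lemma Ck_onW N f : Ck_on N.+1 U f -> Ck_on N U f.
Proof. by move=> fU s sN; apply: fU; rewrite leqW. Qed.

Lemma smooth_on_partial k f : smooth_on U f -> smooth_on U (partial k f).
Proof. by move=> fU s x Ux; have := fU (rcons s k) x Ux; rewrite foldr_rcons. Qed.

Lemma eq_on_near f g x : (forall y, U y -> f y = g y) -> U x -> \near x, f x = g x.
Proof. by move=> fg Ux; apply: filterS fg _; exact: open_nbhs_nbhs. Qed.

Lemma eq_on_partial k f g x :
  (forall y, U y -> f y = g y) -> U x -> partial k f x = partial k g x.
Proof. by move=> fg Ux; apply: near_eq_derive; exact: eq_on_near. Qed.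

Lemma eq_on_differentiable f g x :
  (forall y, U y -> f y = g y) -> U x -> differentiable f x -> differentiable g x.
Proof. by move=> fg Ux; apply: near_eq_differentiable; exact: eq_on_near. Qed.

Lemma eq_on_Ck N f g : (forall y, U y -> f y = g y) -> Ck_on N U f -> Ck_on N U g.
Proof.
elim: N f g => [|N IH] f g fg.
  by move=> /Ck_on0 fU; apply/Ck_on0 => x Ux; apply: eq_on_differentiable fg Ux (fU x Ux).
move=> /Ck_onS[df dk]; apply/Ck_onS; split=> [x Ux|k].
  exact: eq_on_differentiable fg Ux (df x Ux).
by apply: IH (dk k) => y Uy; exact: eq_on_partial.
Qed.

Lemma eq_on_smooth f g : (forall y, U y -> f y = g y) -> smooth_on U f -> smooth_on U g.
Proof.
by move=> fg /smooth_onP fU; apply/smooth_onP => N; exact: eq_on_Ck (fU N).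
Qed.

Lemma partial_cst k (a : V) x : partial k (cst a : 'rV[R]_m -> V) x = 0.
Proof. exact: derive_cst. Qed.

Lemma Ck_cst N (a : V) : Ck_on N U (cst a).
Proof.
elim: N a => [|N IH] a; first by apply/Ck_on0.
apply/Ck_onS; split=> // k.
have -> : partial k (cst a : 'rV[R]_m -> V) = cst 0.
  by apply/funext => x; rewrite partial_cst.
exact: IH.
Qed.

Lemma partialD k f g x : differentiable f x -> differentiable g x ->
  partial k (f + g) x = partial k f x + partial k g x.
Proof. by move=> df dg; apply: deriveD; exact: diff_derivable. Qed.

Lemma partialN k f x : differentiable f x ->
  partial k (- f) x = - partial k f x.
Proof. by move=> df; apply: deriveN; exact: diff_derivable. Qed.

Lemma CkD N f g : Ck_on N U f -> Ck_on N U g -> Ck_on N U (f + g).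
Proof.
elim: N f g => [|N IH] f g.
  move=> /Ck_on0 df /Ck_on0 dg; apply/Ck_on0 => x Ux.
  by apply: differentiableD; [exact: df|exact: dg].
move=> /Ck_onS[df fU] /Ck_onS[dg gU]; apply/Ck_onS; split=> [x Ux|k].
  by apply: differentiableD; [exact: df|exact: dg].
apply: eq_on_Ck (IH _ _ (fU k) (gU k)) => y Uy.
by rewrite partialD //; [exact: df|exact: dg].
Qed.

Lemma CkN N f : Ck_on N U f -> Ck_on N U (- f).
Proof.
elim: N f => [|N IH] f.
  by move=> /Ck_on0 df; apply/Ck_on0 => x Ux; apply: differentiableN; exact: df.
move=> /Ck_onS[df fU]; apply/Ck_onS; split=> [x Ux|k].
  by apply: differentiableN; exact: df.
by apply: eq_on_Ck (IH _ (fU k)) => y Uy; rewrite partialN //; exact: df.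
Qed.
End Vector.

Section Scalar.
Implicit Types f g : 'rV[R]_m -> R.

Lemma partialM k f g x : differentiable f x -> differentiable g x ->
  partial k (f * g) x = partial k f x * g x + f x * partial k g x.
Proof.
move=> df dg; rewrite /partial deriveM; try exact: diff_derivable.
by rewrite addrC; congr (_ + _); rewrite mulrC.
Qed.

Lemma CkM N f g : Ck_on N U f -> Ck_on N U g -> Ck_on N U (f * g).
Proof.
elim: N f g => [|N IH] f g.
  move=> /Ck_on0 df /Ck_on0 dg; apply/Ck_on0 => x Ux.
  by apply: differentiableM; [exact: df|exact: dg].
move=> fN gN; have fN' := Ck_onW fN; have gN' := Ck_onW gN.
move: fN gN => /Ck_onS[df fU] /Ck_onS[dg gU]; apply/Ck_onS; split=> [x Ux|k].
  by apply: differentiableM; [exact: df|exact: dg].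
apply: eq_on_Ck (CkD (IH _ _ (fU k) gN') (IH _ _ fN' (gU k))) => y Uy.
by rewrite partialM //; [exact: df|exact: dg].
Qed.

Definition inv_fun f : 'rV[R]_m -> R := fun x => (f x)^-1.

Lemma CkV N f : (forall x, U x -> f x != 0) -> Ck_on N U f -> Ck_on N U (inv_fun f).
Proof.
move=> f0; elim: N => [|N IH].
  by move=> /Ck_on0 df; apply/Ck_on0 => x Ux; apply: differentiableV; [exact: df|exact: f0].
move=> fN; have gN := IH (Ck_onW fN); move: fN => /Ck_onS[df fU].
have dg x : U x -> differentiable (inv_fun f) x.
  by move=> Ux; apply: differentiableV; [exact: df|exact: f0].
apply/Ck_onS; split=> // k.
apply: eq_on_Ck (CkN (CkM (CkM gN gN) (fU k))) => y Uy.
rewrite /partial/= /inv_fun deriveV ?f0//; last by apply: diff_derivable; exact: df.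
rewrite !fctE -mulNr; congr (_ * _); rewrite -exprVn expr2; by [].
Qed.

Lemma smoothD f g : smooth_on U f -> smooth_on U g -> smooth_on U (f + g).
Proof. by move=> /smooth_onP fU /smooth_onP gU; apply/smooth_onP => N; apply: CkD. Qed.
Lemma smoothN f : smooth_on U f -> smooth_on U (- f).
Proof. by move=> /smooth_onP fU; apply/smooth_onP => N; apply: CkN. Qed.
Lemma smoothM f g : smooth_on U f -> smooth_on U g -> smooth_on U (f * g).
Proof. by move=> /smooth_onP fU /smooth_onP gU; apply/smooth_onP => N; apply: CkM. Qed.
Lemma smoothV f : (forall x, U x -> f x != 0) -> smooth_on U f -> smooth_on U (inv_fun f).
Proof. by move=> f0 /smooth_onP fU; apply/smooth_onP => N; apply: CkV. Qed.
Lemma smooth_cst (a : R) : smooth_on U (cst a).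
Proof. by apply/smooth_onP => N; exact: Ck_cst. Qed.

Lemma partialC i j f x : smooth_on U f -> U x ->
  partial i (partial j f) x = partial j (partial i f) x.
Proof.
move=> fU Ux; apply: young.
- apply: filterS (open_nbhs_nbhs (conj oU Ux)) => y Uy.
  exact: smooth_on_differentiable fU Uy.
- exact: smooth_on_differentiable (smooth_on_partial j fU) Ux.
- exact: smooth_on_differentiable (smooth_on_partial i fU) Ux.
Qed.
End Scalar.

Section MatrixValued.
Context {p q : nat}.
Implicit Types M : 'rV[R]_m -> 'M[R]_(p, q).

Lemma differentiable_entry M x i j :
  differentiable M x -> differentiable (fun y => M y i j) x.
Proof.
move=> dM; have dc := @differentiable_coord R p q (M x) i j.
exact: (differentiable_comp dM dc).
Qed.

Lemma partial_entry k M x i j :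
  differentiable M x -> partial k M x i j = partial k (fun y => M y i j) x.
Proof.
by move=> /diff_derivable dM; rewrite {1}/partial derive_mx // mxE.
Qed.

Lemma Ck_entry N M i j : Ck_on N U M -> Ck_on N U (fun y => M y i j).
Proof.
elim: N M => [|N IH] M.
  by move=> /Ck_on0 dM; apply/Ck_on0 => x Ux; exact: differentiable_entry (dM x Ux).
move=> /Ck_onS[dM MU]; apply/Ck_onS; split=> [x Ux|k].
  exact: differentiable_entry (dM x Ux).
by apply: eq_on_Ck (IH _ (MU k)) => y Uy; rewrite partial_entry//; exact: dM.
Qed.

Lemma smooth_entry M i j : smooth_on U M -> smooth_on U (fun y => M y i j).
Proof. by move=> /smooth_onP MU; apply/smooth_onP => N; exact: Ck_entry. Qed.
End MatrixValued.
End Domain.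

Section Composition.
Context {m n : nat} (U : set 'rV[R]_m) (V : set 'rV[R]_n).
Hypotheses (oU : open U) (oV : open V).
Variable phi : 'rV[R]_m -> 'rV[R]_n.
Hypotheses (UV : forall x, U x -> V (phi x)).

Lemma partial_comp k (f : 'rV[R]_n -> R) x :
  differentiable phi x -> differentiable f (phi x) ->
  partial k (f \o phi) x = \sum_c partial k (fun y => phi y 0 c) x * partial c f (phi x).
Proof.
move=> dphi df; rewrite /partial deriveE; last exact: differentiable_comp.
rewrite diff_comp //=.
have -> : 'd phi x (delta_mx 0 k) =
    \sum_c partial k (fun y => phi y 0 c) x *: delta_mx 0 c.
  rewrite -deriveE // [LHS]row_sum_delta; apply: eq_bigr => c _.
  by congr (_ *: _); exact: partial_entry.
rewrite linear_sum; apply: eq_bigr => c _; rewrite linearZ /=.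
by rewrite /partial (deriveE _ df).
Qed.

Lemma Ck_comp N (f : 'rV[R]_n -> R) :
  Ck_on N U phi -> Ck_on N V f -> Ck_on N U (f \o phi).
Proof.
elim: N f => [|N IH] f.
  move=> /Ck_on0 dp /Ck_on0 df; apply/Ck_on0 => x Ux.
  by apply: differentiable_comp; [exact: dp|exact: df (UV Ux)].
move=> pN fN; have pN' := Ck_onW pN.
have dp x : U x -> differentiable phi x by exact: Ck_on_differentiable pN.
have df x : V x -> differentiable f x by exact: Ck_on_differentiable fN.
apply/Ck_onS; split=> [x Ux|k].
  by apply: differentiable_comp; [exact: dp|exact: df (UV Ux)].
have /Ck_onS[_ pU] := pN; have /Ck_onS[_ fV] := fN.
pose F c : 'rV[R]_m -> R := (fun y => partial k phi y 0 c) * (partial c f \o phi).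
apply: (@eq_on_Ck _ _ oU _ _ (\sum_c F c)).
  move=> y Uy; rewrite partial_comp; [|exact: dp|exact: df (UV Uy)].
  rewrite fct_sumE; apply: eq_bigr => c _.
  by rewrite /F -partial_entry //; exact: dp.
elim/big_ind : _ => [|f1 f2|c _]; first exact: Ck_cst.
  exact: CkD.
apply: CkM => //; last exact: IH.
exact: Ck_entry.
Qed.

Lemma smooth_comp (f : 'rV[R]_n -> R) :
  smooth_on U phi -> smooth_on V f -> smooth_on U (f \o phi).
Proof. by move=> /smooth_onP pU /smooth_onP fU; apply/smooth_onP => N; apply: Ck_comp. Qed.
End Composition.
End Ck.

(** * The ring of smooth functions on an open set *)

Section SmoothRing.
Context {R : realType} {m : nat}.
Local Notation E := 'rV[R]_m.

(** Functions on U are extended by 0, so that equality in the ring is equality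
    on U.  The unit is the indicator function of U, and the ring is trivial when
    U is empty.  The proof of openness is a parameter because the ring operations
    need it. *)
Record smooth_fun (U : set E) (oU : open U) := SmoothFun {
  sfun :> E -> R;
  sfun_smooth : smooth_on U sfun;
  sfun_out : forall x, ~ U x -> sfun x = 0 }.

Variables (U : set E) (oU : open U).
Local Notation A := (smooth_fun oU).
Implicit Types (a b c : A) (f g : E -> R).

HB.instance Definition _ := gen_eqMixin A.
HB.instance Definition _ := gen_choiceMixin A.

Lemma smooth_fun_ext a b : (forall x, U x -> a x = b x) -> a = b.
Proof.
case: a b => [f fU f0] [g gU g0] /= fg.
have e : f = g.
  by apply/funext => x; have [/fg//|Ux] := pselect (U x); rewrite f0 // g0.
by subst g; congr SmoothFun; exact: Prop_irrelevance.
Qed.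

Definition extend0 f : E -> R := fun x => if `[< U x >] then f x else 0.

Lemma extend0E f x : U x -> extend0 f x = f x.
Proof. by move=> Ux; rewrite /extend0; case: asboolP. Qed.

Lemma extend0_smooth f : smooth_on U f -> smooth_on U (extend0 f).
Proof. by apply: (eq_on_smooth oU) => x Ux; rewrite extend0E. Qed.

Lemma extend0_out f x : ~ U x -> extend0 f x = 0.
Proof. by rewrite /extend0; case: asboolP. Qed.

Definition restrict f (fU : smooth_on U f) : A :=
  SmoothFun oU (extend0_smooth fU) (@extend0_out f).

Lemma restrictE f (fU : smooth_on U f) x : U x -> restrict fU x = f x.
Proof. exact: extend0E. Qed.

Definition smooth_fun0 : A := restrict (smooth_cst (U := U) 0).
Definition smooth_fun1 : A := restrict (smooth_cst (U := U) 1).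
Definition smooth_funD a b : A := restrict (smoothD oU (sfun_smooth a) (sfun_smooth b)).
Definition smooth_funN a : A := restrict (smoothN oU (sfun_smooth a)).
Definition smooth_funM a b : A := restrict (smoothM oU (sfun_smooth a) (sfun_smooth b)).

Lemma smooth_funDA : associative smooth_funD.
Proof.
by move=> a b c; apply: smooth_fun_ext => x Ux; rewrite !(restrictE _ Ux, fctE) addrA.
Qed.
Lemma smooth_funDC : commutative smooth_funD.
Proof.
by move=> a b; apply: smooth_fun_ext => x Ux; rewrite !(restrictE _ Ux, fctE) addrC.
Qed.
Lemma smooth_fun0D : left_id smooth_fun0 smooth_funD.
Proof.
by move=> a; apply: smooth_fun_ext => x Ux; rewrite !(restrictE _ Ux, fctE) add0r.
Qed.
Lemma smooth_funND : left_inverse smooth_fun0 smooth_funN smooth_funD.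
Proof.
by move=> a; apply: smooth_fun_ext => x Ux; rewrite !(restrictE _ Ux, fctE) addNr.
Qed.
HB.instance Definition _ :=
  GRing.isZmodule.Build A smooth_funDA smooth_funDC smooth_fun0D smooth_funND.

Lemma smooth_funMA : associative smooth_funM.
Proof.
by move=> a b c; apply: smooth_fun_ext => x Ux; rewrite !(restrictE _ Ux, fctE) mulrA.
Qed.
Lemma smooth_funMC : commutative smooth_funM.
Proof.
by move=> a b; apply: smooth_fun_ext => x Ux; rewrite !(restrictE _ Ux, fctE) mulrC.
Qed.
Lemma smooth_fun1M : left_id smooth_fun1 smooth_funM.
Proof.
by move=> a; apply: smooth_fun_ext => x Ux; rewrite !(restrictE _ Ux, fctE) mul1r.
Qed.
Lemma smooth_funMD : left_distributive smooth_funM +%R.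
Proof.
by move=> a b c; apply: smooth_fun_ext => x Ux; rewrite !(restrictE _ Ux, fctE) mulrDl.
Qed.
HB.instance Definition _ :=
  GRing.Zmodule_isComPzRing.Build A smooth_funMA smooth_funMC smooth_fun1M smooth_funMD.

(** Evaluation maps the unit, the indicator function of U, to 1 only at the
    points of U; carrying the proof of membership makes it a ring morphism. *)
Definition eval_at x (Ux : U x) a : R := a x.
Arguments eval_at : simpl never.

Section Evaluation.
Variables (x : E) (Ux : U x).
Local Notation eval_at := (eval_at Ux).

Let eval_at_zmod : zmod_morphism eval_at.
Proof.
by move=> a b; rewrite /eval_at [LHS]restrictE // !fctE; congr (_ + _); exact: restrictE.
Qed.
Let eval_at_monoid : monoid_morphism eval_at.
Proof. by split=> [|a b]; rewrite /eval_at [LHS]restrictE. Qed.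

HB.instance Definition _ := GRing.isZmodMorphism.Build A R eval_at eval_at_zmod.
HB.instance Definition _ := GRing.isMonoidMorphism.Build A R eval_at eval_at_monoid.
End Evaluation.

Lemma eval_at_ext a b : (forall x (Ux : U x), eval_at Ux a = eval_at Ux b) -> a = b.
Proof. exact: smooth_fun_ext. Qed.

Lemma eval_at_restrict f (fU : smooth_on U f) x (Ux : U x) : eval_at Ux (restrict fU) = f x.
Proof. exact: restrictE. Qed.

Lemma sfun_differentiable a x : U x -> differentiable a x.
Proof. exact: smooth_on_differentiable (sfun_smooth a). Qed.

(** The derivations are opaque, so that two iterated partial derivatives are
    never compared by unfolding them to limits. *)
Lemma smooth_partial_subproof : {d : 'I_m -> A -> A |
  forall k a x (Ux : U x), eval_at Ux (d k a) = partial k a x}.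
Proof.
exists (fun k a => restrict (smooth_on_partial k (sfun_smooth a))) => k a x Ux.
exact: restrictE.
Qed.
Definition smooth_partial := sval smooth_partial_subproof.

Lemma eval_at_partial k a x (Ux : U x) : eval_at Ux (smooth_partial k a) = partial k a x.
Proof. exact: (svalP smooth_partial_subproof). Qed.

Lemma smooth_partial_zmod k : zmod_morphism (smooth_partial k).
Proof.
move=> a b; apply: eval_at_ext => x Ux; rewrite rmorphB /= !eval_at_partial.
have dN : differentiable (- (b : E -> R)) x.
  by apply: differentiableN; exact: sfun_differentiable.
rewrite -(partialN _ (sfun_differentiable b Ux)) -(partialD _ (sfun_differentiable a Ux) dN).
by apply: (eq_on_partial oU) => // y Uy; exact: (rmorphB (eval_at Uy)).
Qed.
HB.instance Definition _ k :=
  GRing.isZmodMorphism.Build A A (smooth_partial k) (@smooth_partial_zmod k).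

Lemma smooth_partialM k a b :
  smooth_partial k (a * b) = smooth_partial k a * b + a * smooth_partial k b.
Proof.
apply: eval_at_ext => x Ux; rewrite rmorphD !rmorphM /= !eval_at_partial.
rewrite -(partialM _ (sfun_differentiable a Ux) (sfun_differentiable b Ux)).
by apply: (eq_on_partial oU) => // y Uy; exact: (rmorphM (eval_at Uy)).
Qed.

Lemma smooth_partialC i j a :
  smooth_partial i (smooth_partial j a) = smooth_partial j (smooth_partial i a).
Proof.
apply: eval_at_ext => x Ux.
rewrite (eval_at_partial i (smooth_partial j a) Ux).
rewrite (eval_at_partial j (smooth_partial i a) Ux).
rewrite (eq_on_partial oU i (fun y (Uy : U y) => eval_at_partial j a Uy) Ux).
rewrite (eq_on_partial oU j (fun y (Uy : U y) => eval_at_partial i a Uy) Ux).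
exact: (partialC oU _ _ (sfun_smooth a) Ux).
Qed.

Definition smooth_der : derivations m A :=
  @Derivations m A (fun k => smooth_partial k) smooth_partialM smooth_partialC.
End SmoothRing.

Arguments eval_at : simpl never.

Section Pullback.
Context {R : realType} {m n : nat}.
Variables (U : set 'rV[R]_m) (V : set 'rV[R]_n) (oU : open U) (oV : open V).
Variable phi : 'rV[R]_m -> 'rV[R]_n.
Hypotheses (phiU : smooth_on U phi) (UV : forall x, U x -> V (phi x)).
Local Notation A := (smooth_fun oU).
Local Notation B := (smooth_fun oV).

Definition pullback (b : B) : A :=
  restrict oU (smooth_comp oU UV phiU (sfun_smooth b)).

Arguments pullback : simpl never.

Lemma eval_at_pullback b x (Ux : U x) : eval_at Ux (pullback b) = eval_at (UV Ux) b.
Proof. exact: restrictE. Qed.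

Let pullback_zmod : zmod_morphism pullback.
Proof. move=> a b; apply: eval_at_ext => x Ux.
by rewrite eval_at_pullback !rmorphB /= !eval_at_pullback. Qed.
Let pullback_monoid : monoid_morphism pullback.
Proof.
split=> [|a b]; apply: eval_at_ext => x Ux; first by rewrite eval_at_pullback !rmorph1.
by rewrite rmorphM /= !eval_at_pullback rmorphM.
Qed.
HB.instance Definition _ := GRing.isZmodMorphism.Build B A pullback pullback_zmod.
HB.instance Definition _ := GRing.isMonoidMorphism.Build B A pullback pullback_monoid.

Definition coordinates : 'rV[A]_n := \row_c restrict oU (smooth_entry oU 0 c phiU).

Lemma pullback_chain k b :
  smooth_der oU k (pullback b) =
  \sum_c smooth_der oU k (coordinates 0 c) * pullback (smooth_der oV c b).
Proof.
apply: eval_at_ext => x Ux; rewrite rmorph_sum /= eval_at_partial.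
transitivity (partial k (b \o phi) x).
  by apply: (eq_on_partial oU) => // y Uy; exact: restrictE.
rewrite partial_comp; last 2 first.
- exact: smooth_on_differentiable phiU Ux.
- exact: sfun_differentiable (UV Ux).
apply: eq_bigr => c _; rewrite rmorphM /=.
rewrite eval_at_partial eval_at_pullback eval_at_partial; congr (_ * _).
by rewrite mxE; apply: (eq_on_partial oU) => // y Uy; rewrite [RHS]restrictE.
Qed.
End Pullback.

(** * Tensor fields in a chart as elements of the ring *)

Section Represent.
Context {R : realType} {m : nat} (U : set 'rV[R]_m) (oU : open U).
Local Notation E := 'rV[R]_m.
Local Notation A := (smooth_fun oU).
Local Notation D := (smooth_der oU).

Definition represents (f : E -> R) (a : A) := forall x (Ux : U x), f x = eval_at Ux a.

Definition represents_mx p q (f : E -> 'M[R]_(p, q)) (a : 'M[A]_(p, q)) :=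
  forall x (Ux : U x), f x = map_mx (eval_at Ux) a.

Lemma represents_entry p q (f : E -> 'M[R]_(p, q)) a i j :
  represents_mx f a -> represents (fun y => f y i j) (a i j).
Proof. by move=> fa x Ux; rewrite (fa x Ux) mxE. Qed.

(** Partial derivatives on U see only the values on U, because U is open. *)
Lemma represents_partial k f a :
  represents f a -> represents (partial k f) (D k a).
Proof. by move=> fa x Ux; rewrite [RHS]eval_at_partial; apply: (eq_on_partial oU). Qed.

Lemma represents_partial_mx k p q (f : E -> 'M[R]_(p, q)) a :
  represents_mx f a -> represents_mx (partial k f) (map_mx (D k) a).
Proof.
move=> fa x Ux.
have df i j : derivable (fun y => f y i j) x (delta_mx 0 k).
  apply/diff_derivable.
  apply: (eq_on_differentiable oU _ Ux (sfun_differentiable (a i j) Ux)).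
  by move=> y Uy; rewrite (fa y Uy) mxE.
rewrite {1}/partial derive_mx; last exact/derivable_mxP.
by apply/matrixP => i j; rewrite !mxE -(represents_partial k (represents_entry i j fa)).
Qed.

Lemma lift_smooth p q (f : E -> 'M[R]_(p, q)) :
  smooth_on U f -> exists a, represents_mx f a.
Proof.
move=> fU; exists (\matrix_(i, j) restrict oU (smooth_entry oU i j fU)) => x Ux.
by apply/matrixP => i j; rewrite !mxE eval_at_restrict.
Qed.

Definition half_fun : A := restrict oU (smooth_cst (U := U) 2^-1).

Lemma eval_at_half x (Ux : U x) : eval_at Ux half_fun = 2^-1.
Proof. by rewrite eval_at_restrict. Qed.

Lemma half_funE : half_fun + half_fun = 1.
Proof. by apply: eval_at_ext => x Ux; rewrite rmorphD rmorph1 /= !eval_at_half; field. Qed.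

Section Metric.
Variables (G : E -> 'M[R]_m) (g q : 'M[A]_m).
Hypotheses (Gg : represents_mx G g) (gq : g *m q = 1%:M).

Lemma invmxE x (Ux : U x) : invmx (G x) = map_mx (eval_at Ux) q.
Proof.
have e : G x *m map_mx (eval_at Ux) q = 1%:M by rewrite (Gg Ux) -map_mxM gq map_mx1.
have [uG _] := mulmx1_unit e.
by rewrite -[RHS]mul1mx -(mulVmx uG) -mulmxA e mulmx1.
Qed.

Lemma gtraceE p (F : 'I_m -> 'I_m -> 'rV[R]_p) B x (Ux : U x) :
  (forall i j, F i j = map_mx (eval_at Ux) (B i j)) ->
  gtrace G x F = map_mx (eval_at Ux) (agtrace q B).
Proof.
move=> FB; rewrite raddf_sum; apply: eq_bigr => i _.
rewrite raddf_sum; apply: eq_bigr => j _.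
by rewrite /= map_mxZ FB invmxE mxE.
Qed.

Lemma gtraceE_scalar (F : 'I_m -> 'I_m -> R) (B : 'I_m -> 'I_m -> A) x (Ux : U x) :
  (forall i j, F i j = eval_at Ux (B i j)) ->
  gtrace (V := R^o) G x F = eval_at Ux (\sum_i \sum_j q i j * B i j).
Proof.
move=> FB; rewrite rmorph_sum; apply: eq_bigr => i _.
rewrite rmorph_sum; apply: eq_bigr => j _.
by rewrite /= rmorphM FB invmxE mxE.
Qed.

Lemma represents_christoffel k i j :
  represents (christoffel G k i j) (Gamma D half_fun g q k i j).
Proof.
move=> x Ux; rewrite rmorphM /= eval_at_half; congr (_ * _).
rewrite rmorph_sum; apply: eq_bigr => l _.
rewrite rmorphM rmorphB rmorphD /= (invmxE Ux) mxE; congr (_ * (_ + _ - _));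
 exact: (represents_partial _ (represents_entry _ _ Gg)).
Qed.

Lemma represents_riemann l k i j :
  represents (riemann G l k i j) (ariemann D half_fun g q l k i j).
Proof.
move=> x Ux; rewrite rmorphD rmorphB rmorph_sum /=.
congr (_ - _ + _); try exact: (represents_partial _ (represents_christoffel _ _ _)).
apply: eq_bigr => p _; rewrite rmorphB /=; congr (_ - _);
  by rewrite rmorphM /=; congr (_ * _); exact: represents_christoffel.
Qed.

Lemma represents_hessian f a : represents f a -> forall i j,
  represents (fun x => hessian G f x i j) (ahessian D half_fun g q a i j).
Proof.
move=> fa i j x Ux; rewrite mxE rmorphB rmorph_sum /=; congr (_ - _).
  exact: (represents_partial _ (represents_partial _ fa)).
apply: eq_bigr => k _; rewrite rmorphM (represents_christoffel _ _ _ Ux).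
by rewrite (represents_partial _ fa).
Qed.

Lemma represents_gradient f a : represents f a -> forall k,
  represents (fun x => gradient G f x 0 k) (\sum_l q k l * D l a).
Proof.
move=> fa k x Ux; rewrite mxE rmorph_sum; apply: eq_bigr => l _.
by rewrite rmorphM (represents_partial _ fa) invmxE mxE.
Qed.

Lemma represents_laplacian f a : represents f a ->
  represents (laplacian G f) (alaplacian D half_fun g q a).
Proof.
move=> fa x Ux; rewrite rmorphN rmorph_sum; congr (- _); apply: eq_bigr => k _.
have fG := represents_gradient fa.
rewrite rmorphD rmorph_sum /= (represents_partial _ (fG _)); congr (_ + _).
apply: eq_bigr => p _.
by rewrite rmorphM (represents_christoffel _ _ _ Ux) (fG p x Ux).
Qed.

Section Tensor.
Variables (S : E -> 'M[R]_m) (s : 'M[A]_m).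
Hypothesis Ss : represents_mx S s.

Lemma represents_nabla2 k i j : represents (nabla2 G S k i j) (anabla2 D half_fun g q s k i j).
Proof.
move=> x Ux; rewrite rmorphB rmorph_sum /=; congr (_ - _).
  exact: (represents_partial _ (represents_entry _ _ Ss)).
apply: eq_bigr => p _; rewrite rmorphD /=; congr (_ + _); rewrite rmorphM /=;
  congr (_ * _); try exact: represents_christoffel; by rewrite (Ss Ux) mxE.
Qed.

Lemma represents_nabla_nabla2 l k i j :
  represents (nabla_nabla2 G S l k i j) (anabla_nabla2 D half_fun g q s l k i j).
Proof.
move=> x Ux; rewrite rmorphB rmorph_sum /=; congr (_ - _).
  exact: (represents_partial _ (represents_nabla2 _ _ _)).
apply: eq_bigr => p _; rewrite 2!rmorphD /=; congr (_ + _ + _); rewrite rmorphM /=;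
  congr (_ * _); try exact: represents_christoffel; exact: represents_nabla2.
Qed.

Lemma represents_rough_laplacian i j :
  represents (fun x => rough_laplacian G S x i j)
    (- \sum_l \sum_k q l k * anabla_nabla2 D half_fun g q s l k i j).
Proof.
move=> x Ux; rewrite mxE rmorphN; congr (- _); apply: gtraceE_scalar => l k.
exact: represents_nabla_nabla2.
Qed.
End Tensor.
End Metric.

(** The determinant is a unit of the ring, so the cofactor formula inverts the
    metric over the ring and the inverse is again smooth. *)
Lemma inverse_metric (G : E -> 'M[R]_m) (g : 'M[A]_m) :
  represents_mx G g -> (forall x, U x -> \det (G x) != 0) ->
  exists q, g *m q = 1%:M.
Proof.
move=> Gg dG.
have dg0 x : U x -> sfun (\det g) x != 0.
  move=> Ux; rewrite -[sfun _ x]/(eval_at Ux _) -det_map_mx -(Gg x Ux); exact: dG.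
exists (restrict oU (smoothV oU dg0 (sfun_smooth (\det g))) *: \adj g).
rewrite -scalemxAr mul_mx_adj scale_scalar_mx; congr (_ %:M).
apply: eval_at_ext => x Ux; rewrite rmorphM rmorph1 /= eval_at_restrict.
rewrite /inv_fun -[sfun _ x]/(eval_at Ux _).
by rewrite mulVf //; exact: dg0.
Qed.
End Represent.

(** * The operators of a map in charts as elements of the ring *)

Section RepresentMap.
Context {R : realType} {m n : nat}.
Variables (U : set 'rV[R]_m) (V : set 'rV[R]_n) (oU : open U) (oV : open V).
Variable phi : 'rV[R]_m -> 'rV[R]_n.
Hypotheses (phiU : smooth_on U phi) (UV : forall x, U x -> V (phi x)).
Local Notation A := (smooth_fun oU).
Local Notation B := (smooth_fun oV).
Local Notation D := (smooth_der oU).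
Local Notation DB := (smooth_der oV).
Local Notation psi := (pullback oU (oV := oV) phiU UV).
Variables (G : 'rV[R]_m -> 'M[R]_m) (g q : 'M[A]_m).
Hypotheses (Gg : represents_mx G g) (gq : g *m q = 1%:M).
Variables (H : 'rV[R]_n -> 'M[R]_n) (h r : 'M[B]_n).
Hypotheses (Hh : represents_mx H h) (hr : h *m r = 1%:M).
Local Notation Phi := (coordinates oU phiU).
Local Notation dphi := (differential D Phi).
Local Notation w := (pullback_conn D DB psi Phi (half_fun oV) h r).

Lemma represents_map : represents_mx phi Phi.
Proof. by move=> x Ux; apply/rowP => c; rewrite !mxE eval_at_restrict. Qed.

Lemma represents_differential k : represents_mx (partial k phi) (dphi k).
Proof. exact: represents_partial_mx represents_map. Qed.

Lemma represents_nabla_pb k s a : represents_mx s a ->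
  represents_mx (nabla_pb H phi k s) (cov D w k a).
Proof.
move=> sa x Ux; rewrite /nabla_pb /cov map_mxD; congr (_ + _).
  exact: represents_partial_mx sa x Ux.
apply/rowP => e; rewrite map_mxM !mxE exchange_big; apply: eq_bigr => c _.
rewrite (sa x Ux) !mxE summxE rmorph_sum mulr_sumr; apply: eq_bigr => b _.
rewrite !mxE rmorphM /= eval_at_pullback -(represents_christoffel Hh hr _ _ _ (UV Ux)).
have -> : partial k phi x 0 b = eval_at Ux (D k (restrict oU (smooth_entry oU 0 b phiU))).
  by rewrite (represents_differential k Ux) !mxE.
by rewrite /=; ring.
Qed.

Lemma represents_inner s t a b : represents_mx s a -> represents_mx t b ->
  represents (inner_pb H phi s t) (inner (map_mx psi h) a b).
Proof.
move=> sa tb x Ux; rewrite /inner_pb /bilin /inner.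
have -> : H (phi x) = map_mx (eval_at Ux) (map_mx psi h).
  by rewrite (Hh (UV Ux)); apply/matrixP => i j; rewrite !mxE eval_at_pullback.
by rewrite (sa x Ux) (tb x Ux) map_trmx -!map_mxM mxE.
Qed.

Lemma represents_curvature u v s a b c x (Ux : U x) :
  u = map_mx (eval_at Ux) a -> v = map_mx (eval_at Ux) b -> s = map_mx (eval_at Ux) c ->
  curvature H (phi x) u v s =
  map_mx (eval_at Ux) (pullback_curvature DB psi (half_fun oV) h r a b c).
Proof.
move=> -> -> ->; apply/rowP => l; rewrite [LHS]mxE [RHS]mxE /pullback_curvature.
rewrite mulmx_sumr summxE rmorph_sum.
apply: eq_bigr => i _; rewrite mulmx_sumr summxE rmorph_sum.
have sE t (M : 'rV[A]_n) : (t *: M) 0 l = t * M 0 l by rewrite mxE.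
have mE (M : 'M[A]_n) : (c *m M) 0 l = \sum_k c 0 k * M k l by rewrite mxE.
apply: eq_bigr => j _; rewrite -scalemxAr sE mE.
rewrite rmorphM rmorph_sum /= mulr_sumr; apply: eq_bigr => k _.
rewrite (represents_riemann Hh hr _ _ _ _ (UV Ux)) ariemannE.
have -> : eval_at (UV Ux) (curv_form DB (conn_form DB (half_fun oV) h r) i j k l) =
    eval_at Ux (map_mx psi (curv_form DB (conn_form DB (half_fun oV) h r) i j) k l).
  by rewrite [in RHS]mxE eval_at_pullback.
by rewrite !rmorphM /= !(mxE _ (fun i j => eval_at Ux _)) mulrA.
Qed.

Local Notation sffA := (second_form D (half_fun oU) g q w dphi).
Local Notation tensA := (atension D (half_fun oU) g q w dphi).
Local Notation cov2A := (nabla_pb2 D (half_fun oU) g q w).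

Lemma represents_second_fundamental_form i j :
  represents_mx (second_fundamental_form G H phi i j) (sffA i j).
Proof.
move=> x Ux; rewrite /second_form map_mxB; congr (_ - _).
  exact: (represents_nabla_pb _ (represents_differential _)).
rewrite raddf_sum /=.
apply: eq_bigr => k _; rewrite map_mxZ (represents_christoffel Gg gq _ _ _ Ux).
by rewrite (represents_differential k Ux).
Qed.

Lemma represents_tension : represents_mx (tension G H phi) tensA.
Proof.
move=> x Ux; apply: (gtraceE Gg gq) => i j.
exact: represents_second_fundamental_form.
Qed.

Lemma represents_trace_nabla_pb2 s a : represents_mx s a ->
  represents_mx (trace_nabla_pb2 G H phi s) (agtrace q (cov2A a)).
Proof.
move=> sa x Ux; apply: (gtraceE Gg gq) => i j.
rewrite /nabla_pb2 map_mxB; congr (_ - _).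
  exact: (represents_nabla_pb _ (represents_nabla_pb _ sa)).
rewrite raddf_sum /=.
apply: eq_bigr => k _; rewrite map_mxZ (represents_christoffel Gg gq _ _ _ Ux).
by rewrite (represents_nabla_pb _ sa).
Qed.

Lemma represents_bitension :
  represents_mx (bitension G H phi)
    (agtrace q (cov2A tensA)
     - agtrace q (fun i j =>
         pullback_curvature DB psi (half_fun oV) h r (dphi i) tensA (dphi j))).
Proof.
move=> x Ux; rewrite map_mxB; congr (_ - _).
  exact: (represents_trace_nabla_pb2 represents_tension).
apply: (gtraceE Gg gq) => i j; apply: represents_curvature.
- exact: represents_differential.
- exact: represents_tension.
- exact: represents_differential.
Qed.

Lemma represents_tension_sqnorm :
  represents (tension_sqnorm G H phi)
    (atension_sqnorm D (half_fun oU) g q (map_mx psi h) w dphi).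
Proof. exact: represents_inner represents_tension represents_tension. Qed.

Lemma represents_stress_bienergy :
  represents_mx (stress_bienergy G H phi)
    (astress D (half_fun oU) g q (map_mx psi h) w dphi).
Proof.
have W i j : represents
    (inner_pb H phi (partial i phi) (nabla_pb H phi j (tension G H phi)))
    (dphi_nabla_tau D (half_fun oU) g q (map_mx psi h) w dphi i j).
  apply: represents_inner; first exact: represents_differential.
  exact: represents_nabla_pb represents_tension.
move=> x Ux; apply/matrixP => i j; rewrite !mxE !rmorphB /=; congr (_ - _ - _); last 2 first.
- exact: W.
- exact: W.
rewrite rmorphM /= rmorphD /=; congr ((_ + _) * _).
- rewrite rmorphM /= eval_at_half; congr (_ / _); exact: represents_tension_sqnorm.
- apply: (gtraceE_scalar Gg gq) => a b; exact: W.
- exact: represents_entry.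
Qed.

End RepresentMap.

(** * The rough Laplacian of the stress-energy tensor *)

Lemma positive_definite_det (R : realType) m (B : 'M[R]_m) :
  (forall v, v != 0 -> 0 < bilin B v v) -> \det B != 0.
Proof.
move=> Bpos; apply/det0P => -[v v0 vB].
by have := Bpos v v0; rewrite /bilin vB mul0mx mxE ltxx.
Qed.

Lemma bilin_delta (R : realType) m (B : 'M[R]_m) i j :
  bilin B (delta_mx 0 i) (delta_mx 0 j) = B i j.
Proof. by rewrite /bilin -rowE trmx_delta -colE !mxE. Qed.

Lemma det_mx22 (R : comPzRingType) (B : 'M[R]_2) :
  \det B = B 0 0 * B 1 1 - B 0 1 * B 1 0.
Proof.
rewrite (expand_det_row _ 0) sum_ord2 /cofactor !det_mx11 !mxE /=.
have l00 : lift 0 0 = 1 :> 'I_2 by apply: val_inj.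
have l10 : lift 1 0 = 0 :> 'I_2 by apply: val_inj.
by rewrite l00 l10; ring.
Qed.

Section GaussCurvature.
Context {R : realType} (U : set 'rV[R]_2) (oU : open U).
Local Notation A := (smooth_fun oU).
Local Notation D := (smooth_der oU).
Variables (G : 'rV[R]_2 -> 'M[R]_2) (g q : 'M[A]_2).
Hypotheses (Gg : represents_mx G g) (gq : g *m q = 1%:M).
Hypothesis GT : forall x, U x -> (G x)^T = G x.
Hypothesis detG : forall x, U x -> \det (G x) != 0.

Lemma gauss_curvatureE x :
  gauss_curvature G x =
  (\sum_l riemann G l 1 0 1 x * G x l 0) /
  (G x 0 0 * G x 1 1 - G x 0 1 ^+ 2).
Proof.
rewrite /gauss_curvature /sectional_curvature !bilin_delta; congr (_ / _).
rewrite /bilin trmx_delta -colE !mxE; apply: eq_bigr => l _; congr (_ * _).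
rewrite !mxE (bigD1 0) //= [X in _ + X]big1 ?addr0; last first.
  move=> i i0; rewrite big1 // => j _; rewrite big1 // => k _.
  by rewrite mxE (negPf i0) andbF !mul0r.
rewrite (bigD1 1) //= [X in _ + X]big1 ?addr0; last first.
  move=> j j0; rewrite big1 // => k _.
  by rewrite [X in _ * X * _ * _]mxE (negPf j0) andbF mulr0 !mul0r.
rewrite (bigD1 1) //= [X in _ + X]big1 ?addr0; last first.
  move=> k k0.
  by rewrite [X in _ * _ * X * _]mxE (negPf k0) andbF mulr0 !mul0r.
by rewrite !mxE !eqxx !mul1r.
Qed.

(** On the coordinate frame, the denominator of the sectional curvature is the
    determinant of the metric, which is a unit. *)
Lemma gauss_curvature_lift : exists2 K : A, represents (gauss_curvature G) K &
  K * (g 0 0 * g 1 1 - g 0 1 ^+ 2) =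
    \sum_l ariemann D (half_fun oU) g q l 1 0 1 * g l 0.
Proof.
have detE x : U x -> \det (G x) = G x 0 0 * G x 1 1 - G x 0 1 ^+ 2.
  move=> Ux.
  have GC : G x 1 0 = G x 0 1 by rewrite -[in LHS](GT Ux) mxE.
  by rewrite det_mx22 GC expr2.
pose d := g 0 0 * g 1 1 - g 0 1 ^+ 2.
have dE : represents (fun x => G x 0 0 * G x 1 1 - G x 0 1 ^+ 2) d.
  by move=> x Ux; rewrite rmorphB !rmorphM /= (Gg Ux) !mxE.
have d0 x : U x -> sfun d x != 0.
  by move=> Ux; rewrite -[sfun _ x]/(eval_at Ux _) -(dE x Ux) -detE//; exact: detG.
pose N := \sum_l ariemann D (half_fun oU) g q l 1 0 1 * g l 0.
have NE : represents (fun x => \sum_l riemann G l 1 0 1 x * G x l 0) N.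
  move=> x Ux; rewrite rmorph_sum; apply: eq_bigr => l _; rewrite rmorphM /=.
  by congr (_ * _); [exact: represents_riemann|rewrite (Gg Ux) mxE].
exists (N * restrict oU (smoothV oU d0 (sfun_smooth d))).
  move=> x Ux; rewrite gauss_curvatureE rmorphM /= eval_at_restrict (NE x Ux) (dE x Ux).
  by [].
apply: eval_at_ext => x Ux; rewrite -/d -/N !rmorphM /= eval_at_restrict /inv_fun.
by rewrite -mulrA [X in _ * X](mulVf (d0 x Ux)) mulr1.
Qed.
End GaussCurvature.

(** The ring computation applies with g, q in the ring of the domain U and h, r
    in that of V, moved to U by composition with phi; evaluation at x gives the
    statement on functions. *)
Theorem local_rough_laplacian_stress_bienergy (R : realType) n
  (U : set 'rV[R]_2) (V : set 'rV[R]_n) (oU : open U) (oV : open V)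
  (phi : 'rV[R]_2 -> 'rV[R]_n) (G : 'rV[R]_2 -> 'M[R]_2) (H : 'rV[R]_n -> 'M[R]_n) :
  smooth_on U phi -> (forall x, U x -> V (phi x)) ->
  smooth_on U G -> (forall x, U x -> (G x)^T = G x) ->
  (forall x, U x -> \det (G x) != 0) ->
  smooth_on V H -> (forall x, V x -> (H x)^T = H x) ->
  (forall x, V x -> \det (H x) != 0) ->
  (forall x, U x -> bitension G H phi x = 0) ->
  forall x, U x ->
  rough_laplacian G (stress_bienergy G H phi) x =
    (- 2 * gauss_curvature G x) *: stress_bienergy G H phi x
    + hessian G (tension_sqnorm G H phi) x
    + (gauss_curvature G x * tension_sqnorm G H phi x
       + laplacian G (tension_sqnorm G H phi) x) *: G x.
Proof.
move=> phiU UV GU GT detG HV HT detH bih.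
have [g Gg] := lift_smooth oU GU; have [q gq] := inverse_metric Gg detG.
have [h Hh] := lift_smooth oV HV; have [r hr] := inverse_metric Hh detH.
have gT : g^T = g.
  apply/matrixP => i j; apply: eval_at_ext => x Ux; rewrite mxE.
  by rewrite -!(represents_entry _ _ Gg Ux) -[in LHS](GT x Ux) mxE.
have hT : h^T = h.
  apply/matrixP => i j; apply: eval_at_ext => x Ux; rewrite mxE.
  by rewrite -!(represents_entry _ _ Hh Ux) -[in LHS](HT x Ux) mxE.
have [K KE Kdet] := gauss_curvature_lift Gg gq GT detG.
pose psi := pullback oU (oV := oV) phiU UV.
pose Phi := coordinates oU phiU.
have chain_rule := @pullback_chain R 2 n U V oU oV phi phiU UV.
have hE := half_funE oV. have hU := half_funE oU.
pose dphi := differential (smooth_der oU) Phi.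
pose w := pullback_conn (smooth_der oU) (smooth_der oV) psi Phi (half_fun oV) h r.
have phT : (map_mx psi h)^T = map_mx psi h by rewrite map_trmx hT.
have wh : metric_connection (smooth_der oU) w (map_mx psi h).
  exact: (pullback_metric chain_rule hE hT hr).
pose S := astress (smooth_der oU) (half_fun oU) g q (map_mx psi h) w dphi.
pose t := atension_sqnorm (smooth_der oU) (half_fun oU) g q (map_mx psi h) w dphi.
have SS : represents_mx (stress_bienergy G H phi) S.
  exact: represents_stress_bienergy.
have tt : represents (tension_sqnorm G H phi) t by exact: represents_tension_sqnorm.
have ST : S^T = S by exact: astressT.
have trS : \sum_a \sum_b q a b * S a b = t.
  rewrite /S astress_trace //.
  have -> : (2%:R - 1 - 1 : smooth_fun oU) = 0 by ring.
  have -> : 2%:R * half_fun oU = 1 by rewrite -[RHS]hU; ring.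
  by rewrite mul0r addr0 mul1r.
have div0 j : \sum_i \sum_k q i k * anabla2 (smooth_der oU) (half_fun oU) g q S i k j = 0.
  have tor i k : cov (smooth_der oU) w i (dphi k) = cov (smooth_der oU) w k (dphi i).
    exact: pullback_torsion.
  have curvR i k s : s *m curv_form (smooth_der oU) w i k =
      pullback_curvature (smooth_der oV) psi (half_fun oV) h r (dphi i) (dphi k) s.
    by rewrite /w (pullback_curv_form chain_rule).
  rewrite (astress_divergence_bitension hU gT gq phT wh tor curvR
    (pullback_curvature_pair_symmetry (smooth_der oV) psi hE hT hr)).
  rewrite [X in inner _ _ X](_ : _ = 0) ?inner0r ?oppr0//.
  apply/rowP => e; rewrite [RHS]mxE; apply: eval_at_ext => x Ux.
  have bitE := represents_bitension phiU UV Gg gq Hh hr.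
  by rewrite -(represents_entry _ _ bitE Ux) bih// mxE rmorph0.
move=> x Ux; apply/matrixP => i j.
rewrite (represents_rough_laplacian Gg gq SS _ _ Ux).
rewrite (arough_laplacian_surface hU gT gq ST trS div0 Kdet).
move: (represents_hessian Gg gq tt i j Ux) (represents_laplacian Gg gq tt Ux).
move: (ahessian _ _ _ _ _ _ _) (alaplacian _ _ _ _ _) => Hess Lap eH eL.
have evE (f : {rmorphism smooth_fun oU -> R}) k s l t' l' g' :
    f (- (k + k) * s + l + (k * t' + l') * g') =
    - (f k + f k) * f s + f l + (f k * f t' + f l') * f g'.
  by rewrite !(rmorphD, rmorphM, rmorphN).
rewrite [LHS](evE (eval_at Ux)) /= -eH -eL -(KE x Ux) -(tt x Ux).
rewrite -(represents_entry i j SS Ux) -(represents_entry i j Gg Ux).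
have mxEs a b (X Y Z : 'M[R]_2) :
    (a *: X + Y + b *: Z) i j = a * X i j + Y i j + b * Z i j.
  by rewrite !mxE.
rewrite mxEs; ring.
Qed.

Lemma smooth_on_subset (R : realType) m (V : normedModType R)
    (U U' : set 'rV[R]_m) (f : 'rV[R]_m -> V) :
  U `<=` U' -> smooth_on U' f -> smooth_on U f.
Proof. by move=> UU' fU' s x /UU'; exact: fU'. Qed.

Lemma local_rep_dom_open (R : realType) m n (S T : topologicalType)
    (phi : S -> T) (c : chart R m S) (d : chart R n T) :
  continuous phi -> open (local_rep_dom phi c d).
Proof.
move=> phiC; rewrite openE => x [cx dx].
have invC : {for x, continuous (chart_inv c)}.
  have := @chart_inv_continuous _ _ _ c; rewrite continuous_open_subspace.
    by apply; rewrite inE.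
  exact: chart_img_open.
have phiinvC : {for x, continuous (phi \o chart_inv c)}.
  exact: continuous_comp invC (phiC _).
apply: filterI; first exact: open_nbhs_nbhs (conj (@chart_img_open _ _ _ c) cx).
exact: phiinvC (open_nbhs_nbhs (conj (@chart_dom_open _ _ _ d) dx)).
Qed.

Lemma gram_det (R : realType) n (M : manifold R n) (g : riemannian_metric M)
    (c : chart R n M) x :
  atlas M c -> chart_img c x -> \det (g c x) != 0.
Proof.
by move=> Mc cx; apply: positive_definite_det => v; exact: gram_pos.
Qed.

Theorem proposition2 (R : realType) (n : nat)
  (M : manifold R 2) (g : riemannian_metric M)
  (N : manifold R n) (h : riemannian_metric N)
  (phi : M -> N) (phi_smooth : smooth_map phi)
  (phi_biharmonic : biharmonic g h phi) :
  forall (p : M) (c : chart R 2 M) (d : chart R n N),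
    atlas M c -> chart_dom c p ->
    atlas N d -> chart_dom d (phi p) ->
    let G := g c in
    let S2 := stress_bienergy G (h d) (local_rep phi c d) in
    let tau2 := tension_sqnorm G (h d) (local_rep phi c d) in
    let K := gauss_curvature G in
    let x := c p in
    rough_laplacian G S2 x =
      (- 2 * K x) *: S2 x + hessian G tau2 x
      + (K x * tau2 x + laplacian G tau2 x) *: G x.
Proof.
move=> p c d Mc cp Nd dp /=.
have [phi_cont phi_smth] := phi_smooth.
apply: (@local_rough_laplacian_stress_bienergy R n (local_rep_dom phi c d) (chart_img d)).
- exact: local_rep_dom_open.
- exact: chart_img_open.
- exact: phi_smth.
- by move=> x [cx dx]; exact: chart_mapP.
- apply: (@smooth_on_subset _ _ _ _ (chart_img c)); last exact: gram_smooth.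
  by move=> x [].
- by move=> x [cx _]; exact: gram_sym.
- by move=> x [cx _]; exact: gram_det.
- exact: gram_smooth.
- by move=> x dx; exact: gram_sym.
- by move=> x dx; exact: gram_det.
- move=> x [cx dx].
  have := phi_biharmonic (chart_inv c x) c d Mc (chart_invP cx) Nd dx.
  by rewrite chart_invK.
- by split; [exact: chart_mapP|rewrite chart_mapK].
Qed.
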